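(* Let $\alpha>0$ and $\varepsilon\ge 0$. The functional $\mathscr H_\varepsilon$ attains a minimum on $N_\alpha$ if one of the following conditions holds: (i) $\alpha>\frac14$ and $0\le\varepsilon<\frac1\alpha$; (ii) $\alpha>0$ and $$0\le \varepsilon\le \frac{1-\tanh\bigl(\frac{1}{2\alpha}\bigr)}{\sqrt{1+\alpha^2}+\frac{\alpha}{4}+\frac{\alpha^2}{4}\sinh\bigl(\frac1\alpha\bigr)-\frac14}.$$
   Context: For $\alpha>0$ let $N_\alpha:=\{u\in H^2(-1,1): u \text{ even},\ u>0 \text{ on } [-1,1],\ u(\pm1)=\alpha,\ u'(\pm1)=0\}$. For positive $u\in H^2(-1,1)$ define the area functional $\mathscr A(u):=2\pi\int_{-1}^1 u\sqrt{1+u'^2}\,dx$, the Willmore functional $$\mathscr W(u):=\frac{\pi}{2}\int_{-1}^1\Bigl(\frac{1}{u\sqrt{1+u'^2}}-\frac{u''}{(1+u'^2)^{3/2}}\Bigr)^2 u\sqrt{1+u'^2}\,dx,$$ and for $\varepsilon\ge0$ the Helfrich functional $\mathscr H_\varepsilon(u):=\mathscr W(u)+\varepsilon\mathscr A(u)$ (these are the Willmore energy and area of the surface of revolution obtained by rotating the graph of $u$ about the $x$-axis). *)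

(* Defs.v *)
From HB Require Import structures.
From mathcomp Require Import all_boot all_order all_algebra.
From mathcomp Require Import all_classical all_reals all_analysis.
Set Implicit Arguments. Unset Strict Implicit. Unset Printing Implicit Defensive.
Import Order.TTheory GRing.Theory Num.Theory.
Import numFieldNormedType.Exports.
Local Open Scope classical_set_scope.
Local Open Scope ring_scope.

Section Defs.
Variable R : realType.
Local Notation mu := (@lebesgue_measure R).

Definition I11 : set R := `[-1%R, 1%R]%classic.

Definition sinhR (x : R) : R := (expR x - expR (- x)) / 2.
Definition coshR (x : R) : R := (expR x + expR (- x)) / 2.
Definition tanhR (x : R) : R := sinhR x / coshR x.

(** [H2rep u u1 g]: u belongs to H^2(-1,1), with (continuous representative
    of the) first derivative u1 and weak second derivative g in L^2(-1,1).
    Concretely: g is measurable, square integrable (and integrable) on [-1,1],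
    u1 x = u1 (-1) + \int_{-1}^x g and u x = u (-1) + \int_{-1}^x u1 for
    x in [-1,1].  This is the standard characterization of H^2 on a bounded
    interval (absolutely continuous u, u' with u'' in L^2). *)
Definition H2rep (u u1 g : R -> R) : Prop :=
  [/\ measurable_fun I11 g,
      mu.-integrable I11 (fun x => (g x)%:E),
      mu.-integrable I11 (fun x => (g x ^+ 2)%:E),
      (forall x, I11 x -> u1 x = u1 (-1) + Rintegral mu `[-1%R, x]%classic g) &
      (forall x, I11 x -> u x = u (-1) + Rintegral mu `[-1%R, x]%classic u1)].

Definition inN (alpha : R) (u u1 g : R -> R) : Prop :=
  [/\ H2rep u u1 g,
      (forall x, I11 x -> u (- x) = u x),
      (forall x, I11 x -> 0 < u x),
      u (-1) = alpha /\ u 1 = alpha &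
      u1 (-1) = 0 /\ u1 1 = 0].

Definition areaF (u u1 : R -> R) : R :=
  2 * pi * Rintegral mu I11 (fun x => u x * Num.sqrt (1 + u1 x ^+ 2)).

Definition willmoreF (u u1 g : R -> R) : \bar R :=
  ((pi / 2)%:E *
   \int[mu]_(x in I11)
     (((1 / (u x * Num.sqrt (1 + u1 x ^+ 2))
        - g x / ((1 + u1 x ^+ 2) * Num.sqrt (1 + u1 x ^+ 2))) ^+ 2
       * (u x * Num.sqrt (1 + u1 x ^+ 2)))%:E))%E.

Definition helfrichF (eps : R) (u u1 g : R -> R) : \bar R :=
  (willmoreF u u1 g + (eps * areaF u u1)%:E)%E.

End Defs.

(* Main.v *)
(* Write s = sqrt (1 + u'^2).  Since (u'/s)' = u''/s^3, completing the square with
   the opposite sign bounds the integrand of W from below by a multiple of -(u'/s)',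
   and for even u this gives W(u) >= 4 pi |u'/s| everywhere.  Hence W(u) <= 4 pi c with
   c < 1 bounds u'; the integral of 1/(u s), which is at most 2 W / pi, then keeps u away
   from 0, and u'' is bounded in L^2.  Along an ultrafilter refining a minimising
   family u' converges uniformly.  As N_alpha is convex, midpoints are admissible, and
   the parallelogram identity turns minimality into the Cauchy property of u'' in L^2;
   Fatou's lemma passes the energy to the limit.
   The bound W <= 4 pi c holds below the energy of a competitor.  In case (i) it is the
   cylinder u = alpha: Cauchy-Schwarz gives W A >= 4 pi^2, so an energy at most that of
   the cylinder forces (W - pi/alpha) (W - 4 pi eps alpha) <= 0.  In case (ii) it is a
   catenoid leaving the boundary circle with horizontal slope, continued by a sphere
   centred at the origin, whose energy is below 4 pi. *)

Require Import Defs.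
From HB Require Import structures.
From mathcomp Require Import all_boot all_order all_algebra.
From mathcomp Require Import all_classical all_reals all_analysis.
From mathcomp Require Import measurable_realfun ring lra.
Import Order.TTheory GRing.Theory Num.Theory.
Import numFieldNormedType.Exports.
Local Open Scope classical_set_scope.
Local Open Scope ring_scope.
Set Implicit Arguments. Unset Strict Implicit. Unset Printing Implicit Defensive.

(** The threshold 4 pi is the Willmore energy of a round sphere, along which u'/s runs from 1 to -1.
    Two obstacles shape the proof. First, u'' is only square integrable, so compositions such as
    u'/s cannot be handled by the calculus of continuously differentiable functions; [chain_rule]
    integrates them by estimating increments to second order. Second, the energy is not jointly
    convex in (u, u', u''). The conditions u'(-1) = u'(1) = 0 remove the term linear in u'', and
    what remains is a positive multiple of u''^2 plus terms in (u, u'). This is convex in u'' alone,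
    and the defect of joint convexity is proportional to the distance of the (u, u'). Uniformly
    close slopes make it negligible, and the midpoint inequality then gives strong convergence of
    u'' without any weak topology. The competitor of case (ii) stays below 4 pi because a catenoid,
    being minimal, has no Willmore energy, while a zone of a sphere has a proper fraction of the
    energy of the whole sphere. *)

(** * Integrals of real functions over compact intervals *)

Section IntervalIntegrals.
Variable R : realType.
Local Notation mu := (@lebesgue_measure R).
Implicit Types (a b c d x y : R) (f g h : R -> R).

Definition L1 a b f := mu.-integrable `[a, b] (EFin \o f).
Definition Int a b f : R := \int[mu]_(x in `[a, b]) f x.

Lemma measurable_cc a b : @measurable _ (measurableTypeR R) `[a, b]%classic.
Proof. exact: measurable_itv. Qed.
Hint Resolve measurable_cc : core.

Lemma subset_cc a b c d : a <= c -> d <= b -> `[c, d]%classic `<=` `[a, b]%classic.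
Proof.
move=> ac db x /=; rewrite !in_itv /= => /andP[cx xd].
by rewrite (le_trans ac cx) (le_trans xd db).
Qed.

Lemma L1S a b c d f : a <= c -> d <= b -> L1 a b f -> L1 c d f.
Proof. by move=> ac db; apply: integrableS => //; exact: subset_cc. Qed.

Lemma L1_measurable a b f : L1 a b f -> measurable_fun `[a, b] f.
Proof. by move/(measurable_int mu)/measurable_EFinP. Qed.

Lemma continuous_L1 a b f : {within `[a, b], continuous f} -> L1 a b f.
Proof. by apply: continuous_compact_integrable; exact: segment_compact. Qed.

Lemma continuous_itvS a b c d f : a <= c -> d <= b ->
  {within `[a, b], continuous f} -> {within `[c, d], continuous f}.
Proof. by move=> ac db; apply: continuous_subspaceW; exact: subset_cc. Qed.

Lemma eq_L1 a b f g : (forall x, a <= x <= b -> f x = g x) -> L1 a b f -> L1 a b g.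
Proof.
move=> fg; apply: eq_integrable => // x; rewrite inE /= in_itv /= => xab.
by rewrite fg.
Qed.

Lemma L1D a b f g : L1 a b f -> L1 a b g -> L1 a b (fun x => f x + g x).
Proof. by move=> fi gi; exact (integrableD (measurable_cc a b) fi gi). Qed.

Lemma L1Z a b k f : L1 a b f -> L1 a b (fun x => k * f x).
Proof. by move=> fi; exact (integrableZl (measurable_cc a b) k fi). Qed.

Lemma L1B a b f g : L1 a b f -> L1 a b g -> L1 a b (fun x => f x - g x).
Proof. by move=> fi gi; exact (integrableB (measurable_cc a b) fi gi). Qed.

Lemma L1_norm a b f : L1 a b f -> L1 a b (fun x => `|f x|).
Proof. by move=> fi; exact (integrable_norm fi). Qed.

Lemma L1_le a b f g : measurable_fun `[a, b] f ->
  (forall x, a <= x <= b -> `|f x| <= g x) -> L1 a b g -> L1 a b f.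
Proof.
move=> mf fg; apply: le_integrable => //; first exact/measurable_EFinP.
move=> x /=; rewrite in_itv /= => xab; rewrite lee_fin.
by rewrite (le_trans (fg _ xab)) // ler_norm.
Qed.

Lemma continuous_itv_measurable a b f :
  {within `[a, b], continuous f} -> measurable_fun `[a, b] f.
Proof. by move=> cf; apply: L1_measurable; exact: continuous_L1. Qed.

Lemma continuous_within_comp (A : set R) f (F : R -> R) :
  continuous F -> {within A, continuous f} -> {within A, continuous (fun x => F (f x))}.
Proof.
by move=> cF cf; apply: (@within_continuous_comp _ _ _ A f F) => // y _; exact: cF.
Qed.

Lemma continuous_itv_bounded a b f : {within `[a, b], continuous f} ->
  exists2 M : R, 0 < M & forall x, a <= x <= b -> `|f x| <= M.
Proof.
move=> cf; have [ab|ba] := leP a b; last first.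
  by exists 1 => // x /andP[ax xb]; move: (le_trans ax xb); rewrite leNgt ba.
have cnf : {within `[a, b], continuous (fun x => `|f x|)}.
  by apply: continuous_within_comp cf; exact: norm_continuous.
have [c _ cmax] := EVT_max ab cnf.
exists (`|f c| + 1) => [|x xab]; first by rewrite ltr_pwDr.
by rewrite (le_trans (cmax x _)) ?in_itv //= lerDl.
Qed.

Lemma L1M a b f g : {within `[a, b], continuous f} -> L1 a b g ->
  L1 a b (fun x => f x * g x).
Proof.
move=> cf gi; have [M M0 fM] := continuous_itv_bounded cf.
apply: (@L1_le _ _ _ (fun x => M * `|g x|)).
- by apply: measurable_funM; [exact: continuous_itv_measurable | exact: L1_measurable].
- by move=> x xab; rewrite normrM ler_wpM2r // fM.
- exact/L1Z/L1_norm.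
Qed.

Lemma IntD a b f g : L1 a b f -> L1 a b g ->
  Int a b (fun x => f x + g x) = Int a b f + Int a b g.
Proof. by move=> fi gi; exact: RintegralD. Qed.

Lemma IntB a b f g : L1 a b f -> L1 a b g ->
  Int a b (fun x => f x - g x) = Int a b f - Int a b g.
Proof. by move=> fi gi; exact: RintegralB. Qed.

Lemma IntZ a b k f : L1 a b f -> Int a b (fun x => k * f x) = k * Int a b f.
Proof. by move=> fi; exact: RintegralZl. Qed.

Lemma eq_Int a b f g : (forall x, a <= x <= b -> f x = g x) -> Int a b f = Int a b g.
Proof. by move=> fg; apply: eq_Rintegral => x; rewrite inE /= in_itv => /fg. Qed.

Lemma le_Int a b f g : L1 a b f -> L1 a b g ->
  (forall x, a <= x <= b -> f x <= g x) -> Int a b f <= Int a b g.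
Proof. by move=> fi gi fg; apply: le_Rintegral => // x /=; rewrite in_itv => /fg. Qed.

Lemma Int_ge0 a b f : (forall x, a <= x <= b -> 0 <= f x) -> 0 <= Int a b f.
Proof. by move=> f0; apply: Rintegral_ge0 => x /=; rewrite in_itv => /f0. Qed.

Lemma norm_Int a b f : L1 a b f -> `|Int a b f| <= Int a b (fun x => `|f x|).
Proof. by move=> fi; exact: le_normr_Rintegral. Qed.

Lemma L1_cst a b k : L1 a b (cst k).
Proof. by apply: continuous_L1 => x; exact: cvg_cst. Qed.

Lemma Int_cst a b k : a <= b -> Int a b (cst k) = k * (b - a).
Proof.
move=> ab; rewrite /Int Rintegral_cst //= lebesgue_measure_itv /= lte_fin.
have [_|ba] := ltP a b; first by rewrite EFinN -EFinB.
by rewrite (@le_anti _ _ a b) ?ab // subrr.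
Qed.

Lemma Int_xx a f : Int a a f = 0.
Proof. by rewrite /Int set_itv1 Rintegral_set1. Qed.

Lemma Int_chasles a b c f : a <= b -> b <= c -> L1 a c f ->
  Int a c f = Int a b f + Int b c f.
Proof.
move=> ab bc fi.
have := @Rintegral_itvB R f (BLeft a) (BRight c) b fi ab bc.
rewrite Rintegral_itv_obnd_cbnd; first by rewrite /Int => <-; rewrite addrC subrK.
by apply: integrableS fi => //; exact: subset_itvr.
Qed.

Lemma Int_sub a b f x y : a <= x -> x <= y -> y <= b -> L1 a b f ->
  Int a y f - Int a x f = Int x y f.
Proof.
move=> ax xy yb fi; have fi' : L1 a y f by exact: (L1S (lexx a) yb fi).
by rewrite (Int_chasles ax xy fi') [X in X - _]addrC addrK.
Qed.

Lemma Int_subset a b c d f : a <= c -> c <= d -> d <= b -> L1 a b f ->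
  (forall x, a <= x <= b -> 0 <= f x) -> Int c d f <= Int a b f.
Proof.
move=> ac cd db fi f0.
rewrite (@Int_chasles a c b) ?(le_trans cd) // (@Int_chasles c d b) //; last exact: L1S fi.
rewrite -[leLHS]add0r lerD // ?lerDl Int_ge0 // => x /andP[cx xd]; rewrite f0 //.
  by rewrite cx (le_trans xd) // (le_trans cd).
by rewrite (le_trans _ cx) ?(le_trans ac).
Qed.

Lemma continuous_Int a b f : a <= b -> L1 a b f ->
  {within `[a, b], continuous (fun x => Int a x f)}.
Proof. by move=> ab fi; exact: parameterized_integral_continuous. Qed.

End IntervalIntegrals.

(** * Primitives of integrable functions and the chain rule for them *)

Section AbsolutelyContinuous.
Variable R : realType.
Local Notation L1 := (@L1 R).
Local Notation Int := (@Int R).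
Implicit Types (a b x y C : R) (f g p F dF G : R -> R).

(* Bisecting n times gains a factor 2 ^- n. *)
Lemma quadratic_increments_cst a b C f G : 0 <= C -> a <= b ->
  (forall x y, a <= x -> x <= y -> y <= b ->
    `|f y - f x| <= C * ((y - x) * (G y - G x))) -> f b = f a.
Proof.
move=> C0 ab H.
have Hn n : forall x y, a <= x -> x <= y -> y <= b ->
    `|f y - f x| <= C * ((y - x) * (G y - G x)) / 2 ^+ n.
  elim: n => [|n IH] x y ax xy yb; first by rewrite expr0 divr1 H.
  pose m := (x + y) / 2.
  have xm : x <= m by rewrite /m; lra.
  have my : m <= y by rewrite /m; lra.
  have -> : f y - f x = (f y - f m) + (f m - f x) by ring.
  rewrite (le_trans (ler_normD _ _)) //.
  have h1 := IH m y (le_trans ax xm) my yb.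
  have h2 := IH x m ax xm (le_trans my yb).
  rewrite (le_trans (lerD h1 h2)) // exprS /m.
  have p2 : (2 ^+ n : R) != 0 by rewrite expf_neq0.
  by rewrite le_eqVlt; apply/orP; left; apply/eqP; field.
apply/eqP; rewrite -subr_eq0 -normr_le0; apply/ler_addgt0Pr => e e0; rewrite add0r.
set K := C * ((b - a) * (G b - G a)).
have K0 : 0 <= K by apply: le_trans (H a b _ _ _).
have [n Kn] : exists n : nat, K / e <= n%:R.
  exists (Num.truncn (K / e)).+1; apply: ltW; exact: truncnS_gt.
rewrite (le_trans (Hn n a b _ _ _)) // -/K ler_pdivrMr ?exprn_gt0 //.
rewrite mulrC -ler_pdivrMr // (le_trans Kn) // -natrX ler_nat.
exact/ltnW/ltn_expl.
Qed.

(** Integrates [(|g| - l)^2 >= 0] with [l] the mean value of [|g|]. *)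
Lemma cauchy_schwarz_Int a b g : a <= b -> L1 a b g -> L1 a b (fun x => g x ^+ 2) ->
  Int a b (fun x => `|g x|) ^+ 2 <= (b - a) * Int a b (fun x => g x ^+ 2).
Proof.
rewrite le_eqVlt => /predU1P[<-|ab] gi g2i.
  by rewrite Int_xx expr0n /= subrr mul0r.
set A := Int a b _; set B := Int a b _.
have ba0 : 0 < b - a by rewrite subr_gt0.
pose l := A / (b - a).
have : 0 <= Int a b (fun x => (g x ^+ 2 - (2 * l) * `|g x|) + cst (l ^+ 2) x).
  apply: Int_ge0 => x _; rewrite -(real_normK (num_real (g x))) /=.
  by have := sqr_ge0 (`|g x| - l); rewrite sqrrB -mulr_natl; lra.
have ni := L1_norm gi.
rewrite IntD; [|exact/L1B/L1Z | exact: L1_cst].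
rewrite IntB //; last exact: L1Z.
rewrite (IntZ _ ni) (Int_cst _ (ltW ab)) -/A -/B => H.
have -> : A ^+ 2 = (b - a) * (A ^+ 2 / (b - a)) by field; lra.
rewrite ler_pM2l //; move: H; rewrite /l.
have -> : B - 2 * (A / (b - a)) * A + (A / (b - a)) ^+ 2 * (b - a) = B - A ^+ 2 / (b - a).
  by field; lra.
by rewrite subr_ge0.
Qed.

(** Stated for pairs of points rather than from a base point, so that it restricts to subintervals
    at once ([primitive_onS]). *)
Definition primitive_on a b p g := forall x y, a <= x -> x <= y -> y <= b ->
  p y - p x = Int x y g.

Lemma primitive_onS a b x y p g : a <= x -> y <= b ->
  primitive_on a b p g -> primitive_on x y p g.
Proof.
move=> ax yb pg s t xs st ty; apply: pg => //; first exact: le_trans xs.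
exact: le_trans yb.
Qed.

Lemma Int_primitive a b p g : L1 a b g ->
  (forall x, a <= x <= b -> p x = p a + Int a x g) -> primitive_on a b p g.
Proof.
move=> gi pg x y ax xy yb.
rewrite (pg y) ?(le_trans ax xy) // (pg x) ?ax ?(le_trans xy) //.
by rewrite -(Int_sub ax xy yb gi); ring.
Qed.

Lemma primitive_continuous a b p g : a <= b -> L1 a b g -> primitive_on a b p g ->
  {within `[a, b], continuous p}.
Proof.
move=> ab gi pg.
have : {within `[a, b], continuous (fun x => p a + Int a x g)}.
  apply: (@continuous_within_comp _ _ (fun x => Int a x g) (fun z => p a + z)).
    by move=> z; apply: cvgD; [exact: cvg_cst | exact: cvg_id].
  exact: continuous_Int.
apply: subspace_eq_continuous => x; rewrite inE /= in_itv /= => /andP[ax xb].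
by rewrite /from_subspace -(pg a x) // addrC subrK.
Qed.

Lemma primitive_osc a b p g x y : L1 a b g -> primitive_on a b p g ->
  a <= x <= b -> a <= y <= b -> `|p y - p x| <= Int a b (fun t => `|g t|).
Proof.
move=> gi pg; wlog xy : x y / x <= y => [hw xab yab|].
  have [xy|/ltW yx] := leP x y; first exact: hw.
  by rewrite distrC; exact: hw.
move=> /andP[ax xb] /andP[ay yb]; rewrite pg //.
rewrite (le_trans (norm_Int _)); first by [].
  exact: L1S ax yb gi.
by apply: Int_subset => //; exact: L1_norm.
Qed.

Lemma primitive_osc_sqr a b p g x y : a <= b -> L1 a b g -> L1 a b (fun t => g t ^+ 2) ->
  primitive_on a b p g -> a <= x <= b -> a <= y <= b ->
  (p y - p x) ^+ 2 <= (b - a) * Int a b (fun t => g t ^+ 2).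
Proof.
move=> ab gi g2i pg xab yab; apply: le_trans (cauchy_schwarz_Int ab gi g2i).
have h := primitive_osc gi pg xab yab.
rewrite -(real_normK (num_real (p y - p x))) ler_sqr ?nnegrE //.
exact: le_trans h.
Qed.

(* On a subinterval [x, y] the mean value theorem replaces F (p y) - F (p x) by
   the integral of dF c * g, and dF c - dF (p t) is controlled by the oscillation
   of p, so the error is at most quadratic. *)
Lemma chain_rule a b lo hi C p g F dF : a <= b -> 0 <= C ->
  L1 a b g -> L1 a b (fun t => g t ^+ 2) -> primitive_on a b p g ->
  (forall x, a <= x <= b -> lo <= p x <= hi) ->
  (forall z, lo <= z <= hi -> is_derive z 1 F (dF z)) ->
  (forall y z, lo <= y <= hi -> lo <= z <= hi -> `|dF y - dF z| <= C * `|y - z|) ->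
  {within `[a, b], continuous (fun x => dF (p x))} ->
  F (p b) - F (p a) = Int a b (fun x => dF (p x) * g x).
Proof.
move=> ab C0 gi g2i pg plohi FdF dFC dFp_cont.
have dgi : L1 a b (fun x => dF (p x) * g x) by exact: L1M.
pose f x := F (p x) - Int a x (fun x => dF (p x) * g x).
suff : f b = f a by rewrite /f Int_xx subr0 => <-; ring.
(* With [A] the integral of [|g|] over [x, y], both the intermediate point [c] and every [p t] lie
   within [A] of [p x], so [dF c - dF (p t)] is at most [2 * C * A]. The increment of [f] is then at
   most [2 * C * A^2], and Cauchy-Schwarz bounds [A^2] by [y - x] times the increment of the
   integral of [g^2]. *)
apply: (@quadratic_increments_cst a b (2 * C) f (fun x => Int a x (fun t => g t ^+ 2))) => //.
  by rewrite mulr_ge0.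
move=> x y ax xy yb.
have xab : a <= x <= b by rewrite ax (le_trans xy).
have yab : a <= y <= b by rewrite yb (le_trans ax).
have gxy : L1 x y g := L1S ax yb gi.
have g2xy : L1 x y (fun t => g t ^+ 2) := L1S ax yb g2i.
have dgxy : L1 x y (fun t => dF (p t) * g t) := L1S ax yb dgi.
have pgxy := primitive_onS ax yb pg.
rewrite (Int_sub ax xy yb g2i).
set A := Int x y (fun t => `|g t|).
have A0 : 0 <= A by exact: Int_ge0.
have [c cle Fc] : exists2 c, (lo <= c <= hi) /\ `|c - p x| <= A &
    F (p y) - F (p x) = dF c * (p y - p x).
  have dist : `|p y - p x| <= A.
    by apply: (primitive_osc gxy pgxy); rewrite lexx ?xy.
  have mvt s t : s <= t -> lo <= s -> t <= hi -> exists2 c, c \in `[s, t] &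
      F t - F s = dF c * (t - s).
    move=> st los thi; apply: MVT_segment => //.
      move=> z; rewrite in_itv /= => /andP[sz zt]; apply: FdF.
      by rewrite (le_trans los (ltW sz)) (le_trans (ltW zt)).
    apply: derivable_within_continuous => z; rewrite in_itv /= => /andP[sz zt].
    have zz : lo <= z <= hi by rewrite (le_trans los) // (le_trans zt).
    exact: (@ex_derive _ _ _ _ _ _ _ (FdF z zz)).
  have [pxl pxh] := andP (plohi x xab); have [pyl pyh] := andP (plohi y yab).
  have [pxy|/ltW pyx] := leP (p x) (p y).
    have [c cin Fc] := mvt _ _ pxy pxl pyh.
    move: cin; rewrite in_itv /= => /andP[c1 c2]; exists c => //; split.
      by rewrite (le_trans pxl) // (le_trans c2).
    apply: le_trans dist; rewrite !ger0_norm ?subr_ge0 // lerD2r //.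
  have [c cin Fc] := mvt _ _ pyx pyl pxh.
  move: cin; rewrite in_itv /= => /andP[c1 c2]; exists c.
    split; first by rewrite (le_trans pyl) // (le_trans c2).
    apply: le_trans dist; rewrite !ler0_norm ?subr_le0 // lerN2 lerD2r //.
  by rewrite -opprB Fc; ring.
have -> : f y - f x = Int x y (fun t => (dF c - dF (p t)) * g t).
  rewrite -[RHS](@eq_Int _ _ _ (fun t => dF c * g t - dF (p t) * g t)); last first.
    by move=> t _; rewrite mulrBl.
  rewrite IntB //; last exact: L1Z.
  rewrite IntZ // -(pg x y) // -Fc /f -(Int_sub ax xy yb dgi); ring.
have di : L1 x y (fun t => (dF c - dF (p t)) * g t).
  apply: (@eq_L1 _ _ _ (fun t => dF c * g t - dF (p t) * g t)).
    by move=> t _; rewrite mulrBl.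
  by apply: L1B => //; exact: L1Z.
rewrite (le_trans (norm_Int di)) //.
apply: (@le_trans _ _ (Int x y (fun t => (2 * C * A) * `|g t|))).
  apply: le_Int; [exact: L1_norm | exact/L1Z/L1_norm | move=> t /andP[xt ty]].
  rewrite normrM ler_wpM2r //.
  have tab : a <= t <= b by rewrite (le_trans ax) // (le_trans ty).
  rewrite (le_trans (dFC _ _ cle.1 (plohi t tab))) //.
  have -> : 2 * C * A = C * (A + A) by ring.
  have -> : c - p t = (c - p x) - (p t - p x) by ring.
  rewrite ler_wpM2l // (le_trans (ler_normB _ _)) // lerD //; first exact: cle.2.
  by apply: (primitive_osc gxy pgxy); rewrite ?lexx ?xy ?xt.
rewrite IntZ; last exact: L1_norm.
rewrite -/A -mulrA ler_wpM2l ?mulr_ge0 // -expr2.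
exact: cauchy_schwarz_Int.
Qed.

End AbsolutelyContinuous.

(** * The arc length element and the sine of the inclination angle *)

Section Slope.
Variable R : realType.
Implicit Types (p q : R).

Definition ds p := Num.sqrt (1 + p ^+ 2).

Lemma ds_sqr p : ds p ^+ 2 = 1 + p ^+ 2.
Proof. by rewrite sqr_sqrtr // addr_ge0 // sqr_ge0. Qed.

Lemma ds_ge1 p : 1 <= ds p.
Proof. by rewrite -[leLHS]sqrtr1 ler_sqrt ?lerDl ?sqr_ge0 // addr_ge0 // sqr_ge0. Qed.

Lemma ds_gt0 p : 0 < ds p.
Proof. exact: lt_le_trans (ds_ge1 p). Qed.

Lemma ds_neq0 p : ds p != 0.
Proof. by rewrite gt_eqF // ds_gt0. Qed.

Lemma norm_le_ds p : `|p| <= ds p.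
Proof.
rewrite -ler_sqr ?nnegrE ?(ltW (ds_gt0 _)) // ds_sqr real_normK ?num_real //.
by rewrite lerDr.
Qed.

Lemma ds_le M p : `|p| <= M -> ds p <= ds M.
Proof.
move=> pM; rewrite ler_sqrt ?addr_ge0 ?sqr_ge0 // lerD2l.
rewrite -(real_normK (num_real p)) ler_sqr ?nnegrE // (le_trans _ pM) //.
Qed.

Lemma is_derive_ds p : is_derive p 1 ds (p / ds p).
Proof.
have d1 : is_derive p 1 (cst 1 + (@id R) ^+ 2) (0 + (2%:R * p ^+ 1) *: 1).
  by apply: is_deriveD.
have q0 : 0 < (cst 1 + (@id R) ^+ 2) p by rewrite /= ltr_pwDl ?sqr_ge0.
apply: (is_derive_eq (is_derive1_comp (is_derive1_sqrt q0) d1)).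
rewrite /ds /= add0r /GRing.scale /= mulr1 expr1.
by rewrite invfM mulrACA mulVf // mul1r mulrC.
Qed.

Lemma continuous_ds : continuous ds.
Proof.
move=> p; apply: differentiable_continuous; apply/derivable1_diffP.
exact: (@ex_derive _ _ _ _ _ _ _ (is_derive_ds p)).
Qed.

Lemma ds_lip p q : `|ds p - ds q| <= `|p - q|.
Proof.
have : `|ds p - ds q| * (ds p + ds q) <= `|p - q| * (ds p + ds q).
  have dd0 : 0 <= ds p + ds q by rewrite addr_ge0 // ltW // ds_gt0.
  rewrite -{1}(ger0_norm dd0) -normrM -subr_sqr !ds_sqr.
  have -> : 1 + p ^+ 2 - (1 + q ^+ 2) = (p - q) * (p + q) by ring.
  rewrite normrM ler_wpM2l // (le_trans (ler_normD _ _)) //.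
  by rewrite lerD // norm_le_ds.
by rewrite ler_pM2r // addr_gt0 // ds_gt0.
Qed.

(** The sine of the angle between the tangent and the axis. It stays in ]-1, 1[ however large [p]
    is, so a bound by some [c < 1] is what controls [p] ([ds_slope_le]). *)
Definition slope p := p / ds p.

Lemma is_derive_slope p : is_derive p 1 slope (ds p ^- 3).
Proof.
have h := ds_neq0 p.
apply: (is_derive_eq (is_deriveM (is_derive_id p (1 : R)) (is_deriveV h (is_derive_ds p)))).
rewrite /GRing.scale /= mulr1.
have -> : p * (- ds p ^- 2 * (p / ds p)) + (ds p)^-1 =
  (ds p ^+ 2 - p ^+ 2) / ds p ^+ 3 by field.
by rewrite ds_sqr addrK mul1r.
Qed.

Lemma dsV_bounds p : 0 <= (ds p)^-1 <= 1.
Proof. by rewrite invr_ge0 (ltW (ds_gt0 p)) invf_le1 ?ds_ge1 // ds_gt0. Qed.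

Lemma dsV_lip p q : `|(ds p)^-1 - (ds q)^-1| <= `|p - q|.
Proof.
have -> : (ds p)^-1 - (ds q)^-1 = (ds q - ds p) * ((ds p)^-1 * (ds q)^-1).
  by field; rewrite !ds_neq0.
have /andP[p0 p1] := dsV_bounds p; have /andP[q0 q1] := dsV_bounds q.
rewrite normrM (ger0_norm (mulr_ge0 p0 q0)) distrC.
rewrite -[leRHS]mulr1 ler_pM ?mulr_ge0 ?ds_lip //.
by rewrite -[leRHS]mulr1 ler_pM.
Qed.

(** [1 / ds] is 1-Lipschitz with values in [0, 1], where the n-th power is n-Lipschitz. The
    exponents that occur are 3, the derivative of [slope], and 5, in [k3]. *)
Lemma dsVX_lip n p q : `|ds p ^- n - ds q ^- n| <= n%:R * `|p - q|.
Proof.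
rewrite -!exprVn; have := dsV_lip p q.
have /andP[p0 p1] := dsV_bounds p; have /andP[q0 q1] := dsV_bounds q.
move: (ds p)^-1 (ds q)^-1 p0 p1 q0 q1 => x y x0 x1 y0 y1 xy.
elim: n => [|n IH]; first by rewrite !expr0 subrr normr0 mul0r.
have -> : x ^+ n.+1 - y ^+ n.+1 = x * (x ^+ n - y ^+ n) + (x - y) * y ^+ n.
  by rewrite !exprS; ring.
have -> : n.+1%:R * `|p - q| = n%:R * `|p - q| + `|p - q| by rewrite -natr1; ring.
rewrite (le_trans (ler_normD _ _)) // lerD //.
  by rewrite normrM (ger0_norm x0) (le_trans _ IH) // ler_piMl.
rewrite normrM (le_trans _ xy) // ler_piMr // ger0_norm ?exprn_ge0 //.
exact: exprn_ile1.
Qed.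

Lemma slope_sqr p : slope p ^+ 2 = 1 - ds p ^- 2.
Proof.
rewrite /slope expr_div_n; have -> : p ^+ 2 = ds p ^+ 2 - 1 by rewrite ds_sqr; ring.
by field; exact: ds_neq0.
Qed.

Lemma ds_slope_le c p : 0 <= c -> c < 1 -> `|slope p| <= c -> ds p ^+ 2 <= (1 - c ^+ 2)^-1.
Proof.
move=> c0 c1 pc.
have : slope p ^+ 2 <= c ^+ 2.
  by rewrite -(real_normK (num_real (slope p))) ler_sqr ?nnegrE.
rewrite slope_sqr => h.
have c2 : 0 < 1 - c ^+ 2 by rewrite subr_gt0 exprn_ilt1.
have s2 : 0 < ds p ^+ 2 by rewrite exprn_gt0 // ds_gt0.
rewrite -[leLHS]invrK lef_pV2 ?posrE ?invr_gt0 //; lra.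
Qed.

End Slope.

(** * The integrand of the energy and admissible functions *)

Section Energy.
Variable R : realType.
Local Notation mu := (@lebesgue_measure R).
Implicit Types (A : set R) (eps a b c x y U P G : R) (u p g f : R -> R).

Lemma within_continuousM A f g : {within A, continuous f} -> {within A, continuous g} ->
  {within A, continuous (fun x => f x * g x)}.
Proof. by move=> cf cg x; apply: continuousM; [exact: cf | exact: cg]. Qed.

Lemma within_continuousV A f : (forall x, A x -> f x != 0) ->
  {within A, continuous f} -> {within A, continuous (fun x => (f x)^-1)}.
Proof.
move=> f0 cf; apply: (@within_continuous_comp _ _ _ A f (fun z : R => z^-1)) => // y.
by rewrite inE => -[x Ax <-]; apply: inv_continuous; exact: f0.
Qed.

Lemma within_continuousX A f n : {within A, continuous f} ->
  {within A, continuous (fun x => f x ^+ n)}.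
Proof. by apply: (@continuous_within_comp _ A f (fun z => z ^+ n)); exact: exprn_continuous. Qed.

(** The integrand of [willmoreF] up to unfolding [ds], so that [helfrichE] needs no rewriting under
    the integral. *)
Definition wint u p g x : R :=
  (1 / (u x * ds (p x)) - g x / ((1 + p x ^+ 2) * ds (p x))) ^+ 2 * (u x * ds (p x)).

(** [k1] and [k3] are the coefficients of 1 and of [g^2] when the square in [wint] is expanded
    ([wintE]). [k2] is the area density divided by 2 pi; that it is the inverse of [k1] is the
    source of the Cauchy-Schwarz bound on the product of Willmore energy and area. *)
Definition k1 U P := (U * ds P)^-1.
Definition k2 U P := U * ds P.
Definition k3 U P := U / ds P ^+ 5.
(* The integrand of the Helfrich functional without the cross term - pi u''/s^3, whose
   integral vanishes on N_alpha. *)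
Definition edens eps U P G := pi / 2 * k1 U P + 2 * pi * eps * k2 U P + pi / 2 * k3 U P * G ^+ 2.

Lemma wintE u p g x : u x != 0 ->
  wint u p g x = k1 (u x) (p x) - 2 * (ds (p x) ^- 3 * g x) + k3 (u x) (p x) * g x ^+ 2.
Proof.
move=> u0; rewrite /wint /k1 /k3 -ds_sqr; have := ds_neq0 (p x).
by move: (ds (p x)) => s s0; field; rewrite u0 s0.
Qed.

Lemma wint_ge0 u p g x : 0 < u x -> 0 <= wint u p g x.
Proof. by move=> u0; rewrite mulr_ge0 ?sqr_ge0 // mulr_ge0 // ltW // ds_gt0. Qed.

(* The square with the opposite sign is nonnegative as well. *)
Lemma wint_lower u p g x : 0 < u x -> - 4 * (ds (p x) ^- 3 * g x) <= wint u p g x.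
Proof.
move=> u0; rewrite -subr_ge0.
suff -> : wint u p g x - - 4 * (ds (p x) ^- 3 * g x) =
  (1 / (u x * ds (p x)) + g x / ((1 + p x ^+ 2) * ds (p x))) ^+ 2 * (u x * ds (p x)).
  by rewrite mulr_ge0 ?sqr_ge0 // mulr_ge0 // ltW // ds_gt0.
rewrite /wint -ds_sqr; have := ds_neq0 (p x).
by move: (ds (p x)) => s s0; field; rewrite s0 gt_eqF.
Qed.

Section Admissible.
Variables (alpha : R) (u p g : R -> R).
Hypothesis uN : inN alpha u p g.

Let le11 : -1 <= 1 :> R. Proof. lra. Qed.

Lemma inN_L1 : L1 (-1) 1 g. Proof. by case: uN => -[]. Qed.
Lemma inN_L1_sqr : L1 (-1) 1 (fun x => g x ^+ 2). Proof. by case: uN => -[]. Qed.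

Lemma inN_prim_g : primitive_on (-1) 1 p g.
Proof.
apply: Int_primitive; first exact: inN_L1.
by case: uN => -[_ _ _ pE _] _ _ _ _ x xI; apply: pE; rewrite /I11 /= in_itv.
Qed.

Lemma inN_continuous_p : {within `[-1, 1], continuous p}.
Proof. exact: primitive_continuous inN_L1 inN_prim_g. Qed.

Lemma inN_L1_p : L1 (-1) 1 p. Proof. exact: continuous_L1 inN_continuous_p. Qed.

Lemma inN_prim_p : primitive_on (-1) 1 u p.
Proof.
apply: Int_primitive; first exact: inN_L1_p.
by case: uN => -[_ _ _ _ uE] _ _ _ _ x xI; apply: uE; rewrite /I11 /= in_itv.
Qed.

Lemma inN_continuous_u : {within `[-1, 1], continuous u}.
Proof. exact: primitive_continuous inN_L1_p inN_prim_p. Qed.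

Lemma inN_gt0 x : -1 <= x <= 1 -> 0 < u x.
Proof. by case: uN => _ _ u0 _ _ xI; apply: u0; rewrite /I11 /= in_itv. Qed.

Lemma inN_even x : -1 <= x <= 1 -> u (- x) = u x.
Proof. by case: uN => _ ue _ _ _ xI; apply: ue; rewrite /I11 /= in_itv. Qed.

Lemma inN_uN1 : u (-1) = alpha. Proof. by case: uN => _ _ _ []. Qed.
Lemma inN_u1 : u 1 = alpha. Proof. by case: uN => _ _ _ []. Qed.
Lemma inN_pN1 : p (-1) = 0. Proof. by case: uN => _ _ _ _ []. Qed.
Lemma inN_p1 : p 1 = 0. Proof. by case: uN => _ _ _ _ []. Qed.

(** Evenness is imposed on [u] only, and [p] is tied to [u] by an integral. Hence difference
    quotients: over a step [h] the increment of [u] differs from [p x * h] by at most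
    [sqrt (h^3 K)], [K] being the integral of [g^2]. Adding the estimates at [x] and [- x], evenness
    cancels the increments of [u] and leaves [z^2 <= 4 K h]. At [x = 1], where there is no room for
    a step, the boundary conditions decide. *)
Lemma inN_odd x : 0 <= x <= 1 -> p (- x) = - p x.
Proof.
move=> /andP[x0]; rewrite le_eqVlt => /predU1P[->|x1].
  by rewrite inN_pN1 inN_p1 oppr0.
apply/eqP; rewrite -subr_eq0 opprK; set z := p (- x) + p x.
have gi := inN_L1; have g2i := inN_L1_sqr; have pg := inN_prim_g; have up := inN_prim_p.
set K := Int (-1) 1 (fun t => g t ^+ 2).
have K0 : 0 <= K by apply: Int_ge0 => *; exact: sqr_ge0.
have mean c d s : -1 <= c -> c < d -> d <= 1 -> c <= s <= d ->
    `|u d - u c - p s * (d - c)| ^+ 2 <= (d - c) ^+ 3 * K.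
  move=> c1 cd d1 scd.
  have cd' := ltW cd.
  have gcd := L1S c1 d1 gi; have g2cd := L1S c1 d1 g2i; have pcd := L1S c1 d1 inN_L1_p.
  have pgcd := primitive_onS c1 d1 pg.
  set O := Int c d (fun t => g t ^+ 2).
  have OK : O <= K by apply: Int_subset => // t _; exact: sqr_ge0.
  have O0 : 0 <= O by apply: Int_ge0 => *; exact: sqr_ge0.
  have osc t : c <= t <= d -> `|p t - p s| <= Num.sqrt ((d - c) * O).
    move=> tcd; rewrite -[leLHS]ger0_norm // -sqrtr_sqr ler_wsqrtr //.
    by rewrite real_normK ?num_real // (primitive_osc_sqr _ gcd).
  have -> : u d - u c - p s * (d - c) = Int c d (fun t => p t - p s).
    by rewrite up // IntB //; [rewrite (Int_cst _ cd') | exact: L1_cst].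
  have pi : L1 c d (fun t => p t - p s) by apply: L1B => //; exact: L1_cst.
  have : `|Int c d (fun t => p t - p s)| <= Num.sqrt ((d - c) * O) * (d - c).
    rewrite (le_trans (norm_Int pi)) // -(Int_cst _ cd').
    by apply: le_Int => //; [exact: L1_norm | exact: L1_cst].
  have dc0 : 0 <= d - c by rewrite subr_ge0.
  move=> h; apply: (@le_trans _ _ ((Num.sqrt ((d - c) * O) * (d - c)) ^+ 2)).
    by rewrite ler_sqr ?nnegrE // mulr_ge0 // sqrtr_ge0.
  rewrite exprMn sqr_sqrtr ?mulr_ge0 //.
  rewrite [leLHS](_ : _ = (d - c) ^+ 3 * O); last by ring.
  by rewrite ler_wpM2l // exprn_ge0.
have key h : 0 < h -> h <= 1 - x -> `|z| ^+ 2 <= 4 * K * h.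
  move=> h0 hx.
  have h1 : `|u (x + h) - u x - p x * h| ^+ 2 <= h ^+ 3 * K.
    have := mean x (x + h) x; rewrite (_ : x + h - x = h); last by ring.
    by apply; rewrite ?lexx; lra.
  have h2 : `|u (- x) - u (- (x + h)) - p (- x) * h| ^+ 2 <= h ^+ 3 * K.
    have := mean (- (x + h)) (- x) (- x); rewrite (_ : - x - - (x + h) = h); last by ring.
    by apply; rewrite ?lexx; lra.
  rewrite !inN_even in h2; [|lra..].
  move: h1 h2; rewrite !real_normK ?num_real // => h1 h2.
  have : (z * h) ^+ 2 <= 4 * K * h * h ^+ 2.
    have -> : z * h = - ((u (x + h) - u x - p x * h) + (u x - u (x + h) - p (- x) * h)).
      by rewrite /z; ring.
    move: h1 h2; move: (u (x + h) - u x - p x * h) (u x - u (x + h) - p (- x) * h) => s t.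
    by have := sqr_ge0 (s - t); nra.
  by rewrite exprMn ler_pM2r // exprn_gt0.
have : `|z| ^+ 2 <= 0.
  apply/ler_addgt0Pr => e e0; rewrite add0r.
  pose h := Num.min (1 - x) (e / (4 * K + 1)).
  have K1 : 0 < 4 * K + 1 by lra.
  have h0 : 0 < h by rewrite lt_min subr_gt0 x1 divr_gt0.
  rewrite (le_trans (key h h0 _)) ?ge_min ?lexx //.
  have : h <= e / (4 * K + 1) by rewrite /h ge_min lexx orbT.
  rewrite ler_pdivlMr //; nra.
by rewrite exprn_even_le0 //= normr_eq0.
Qed.

Lemma inN_continuous_k2 : {within `[-1, 1], continuous (fun x => k2 (u x) (p x))}.
Proof.
apply: within_continuousM; first exact: inN_continuous_u.
by apply: continuous_within_comp inN_continuous_p; exact: continuous_ds.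
Qed.

Lemma inN_continuous_k1 : {within `[-1, 1], continuous (fun x => k1 (u x) (p x))}.
Proof.
apply: within_continuousV inN_continuous_k2 => x /=; rewrite in_itv /= => xI.
by rewrite mulf_neq0 ?ds_neq0 // gt_eqF // inN_gt0.
Qed.

Lemma inN_continuous_dsX n : {within `[-1, 1], continuous (fun x => ds (p x) ^- n)}.
Proof.
apply: within_continuousV => [x _|]; first by rewrite expf_neq0 // ds_neq0.
apply: within_continuousX.
by apply: continuous_within_comp inN_continuous_p; exact: continuous_ds.
Qed.

Lemma inN_continuous_k3 : {within `[-1, 1], continuous (fun x => k3 (u x) (p x))}.
Proof. exact: within_continuousM inN_continuous_u (@inN_continuous_dsX 5). Qed.

Lemma inN_L1_slope : L1 (-1) 1 (fun x => ds (p x) ^- 3 * g x).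
Proof. exact: L1M (@inN_continuous_dsX 3) inN_L1. Qed.

Lemma inN_Int_slope a b : -1 <= a -> a <= b -> b <= 1 ->
  Int a b (fun x => ds (p x) ^- 3 * g x) = slope (p b) - slope (p a).
Proof.
move=> a1 ab b1.
have [M M0 pM] := continuous_itv_bounded inN_continuous_p.
symmetry; apply: (@chain_rule _ a b (- M) M 3 p g (@slope R) (fun z => ds z ^- 3)) => //.
- exact: L1S a1 b1 inN_L1.
- exact: L1S a1 b1 inN_L1_sqr.
- exact: primitive_onS a1 b1 inN_prim_g.
- move=> x /andP[ax xb]; rewrite -ler_norml pM //.
  by rewrite (le_trans a1) // (le_trans xb).
- by move=> z _; exact: is_derive_slope.
- by move=> y z _ _; exact: (dsVX_lip 3).
- exact: continuous_itvS a1 b1 (@inN_continuous_dsX 3).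
Qed.

Lemma inN_L1_k1 : L1 (-1) 1 (fun x => k1 (u x) (p x)).
Proof. exact: continuous_L1 inN_continuous_k1. Qed.

Lemma inN_L1_k2 : L1 (-1) 1 (fun x => k2 (u x) (p x)).
Proof. exact: continuous_L1 inN_continuous_k2. Qed.

Lemma inN_L1_k3 : L1 (-1) 1 (fun x => k3 (u x) (p x) * g x ^+ 2).
Proof. exact: L1M inN_continuous_k3 inN_L1_sqr. Qed.

Lemma inN_L1_wint : L1 (-1) 1 (wint u p g).
Proof.
apply: (@eq_L1 _ _ _ (fun x => k1 (u x) (p x) - 2 * (ds (p x) ^- 3 * g x) +
  k3 (u x) (p x) * g x ^+ 2)) => [x xI|].
  by rewrite wintE // gt_eqF // inN_gt0.
apply: L1D inN_L1_k3; apply: L1B inN_L1_k1 _; exact: L1Z inN_L1_slope.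
Qed.

(** The cross term is a multiple of the derivative of [slope (p x)], and [p] vanishes at both
    ends. *)
Lemma Int_wint : Int (-1) 1 (wint u p g) =
  Int (-1) 1 (fun x => k1 (u x) (p x)) + Int (-1) 1 (fun x => k3 (u x) (p x) * g x ^+ 2).
Proof.
rewrite (@eq_Int _ _ _ _ (fun x => k1 (u x) (p x) - 2 * (ds (p x) ^- 3 * g x) +
  k3 (u x) (p x) * g x ^+ 2)); last first.
  by move=> x xI; rewrite wintE // gt_eqF // inN_gt0.
have si := L1Z 2 inN_L1_slope.
rewrite IntD; [|exact: L1B inN_L1_k1 si|exact: inN_L1_k3].
rewrite (IntB inN_L1_k1 si) (IntZ _ inN_L1_slope) inN_Int_slope //.
by rewrite inN_p1 inN_pN1 subrr mulr0 subr0.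
Qed.

Lemma Int_wint_slope a b : -1 <= a -> a <= b -> b <= 1 ->
  4 * (slope (p a) - slope (p b)) <= Int a b (wint u p g).
Proof.
move=> a1 ab b1; have wi := L1S a1 b1 inN_L1_wint; have si := L1S a1 b1 inN_L1_slope.
have -> : 4 * (slope (p a) - slope (p b)) =
    Int a b (fun x => - 4 * (ds (p x) ^- 3 * g x)).
  by rewrite (IntZ _ si) inN_Int_slope //; ring.
apply: le_Int => //; first exact: L1Z.
move=> x /andP[ax xb]; apply: wint_lower; apply: inN_gt0.
by rewrite (le_trans a1) // (le_trans xb).
Qed.

(** At -1, - x, x, 1 the slope takes the values 0, -S, S, 0, and each interval contributes at least
    4 times the drop of the slope across it. If S < 0 the middle interval drops by 2|S|; if S > 0
    the two outer ones drop by S each. Either way this makes 8|S|, and the other intervals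
    contribute at least 0. *)
Lemma slope_le_Int_wint x : -1 <= x <= 1 -> 8 * `|slope (p x)| <= Int (-1) 1 (wint u p g).
Proof.
have slopeN y : slope (- y : R) = - slope y by rewrite /slope /ds sqrrN mulNr.
have slope0 : slope (0 : R) = 0 by rewrite /slope mul0r.
wlog x0 : x / 0 <= x => [hw|] xI.
  have [x0|/ltW x0] := leP 0 x; first exact: hw.
  rewrite -[x]opprK inN_odd; last by lra.
  by rewrite slopeN normrN hw //; lra.
have /andP[_ x1] := xI.
have wi := inN_L1_wint.
have xN : - x <= x by lra.
have xN1 : -1 <= - x by lra.
rewrite (@Int_chasles _ _ (- x)) //; last by lra.
rewrite (@Int_chasles _ (- x) x) //; last exact: L1S _ _ wi.
have xm1 : -1 <= x by lra.
have h1 := Int_wint_slope (lexx _) xN1 (le_trans xN x1).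
have h2 := Int_wint_slope xN1 xN x1.
have h3 := Int_wint_slope xm1 x1 (lexx _).
have pos a b : -1 <= a -> b <= 1 -> 0 <= Int a b (wint u p g).
  move=> a1 b1; apply: Int_ge0 => t /andP[at_ tb]; apply: wint_ge0; apply: inN_gt0.
  by rewrite (le_trans a1) // (le_trans tb).
have q1 := pos _ _ (lexx _) (le_trans xN x1).
have q2 := pos _ _ xN1 x1.
have q3 := pos _ _ xm1 (lexx _).
move: h1 h2 h3; rewrite inN_pN1 inN_p1 inN_odd ?x0 // slopeN slope0.
by case: (ger0P (slope (p x))); lra.
Qed.

Lemma inN_L1_edens eps : L1 (-1) 1 (fun x => edens eps (u x) (p x) (g x)).
Proof.
apply: L1D; first by apply: L1D; apply: L1Z; [exact: inN_L1_k1 | exact: inN_L1_k2].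
apply: (@eq_L1 _ _ _ (fun x => pi / 2 * (k3 (u x) (p x) * g x ^+ 2))) => [x _|].
  by rewrite mulrA.
exact: L1Z inN_L1_k3.
Qed.

Lemma Int_edens eps : Int (-1) 1 (fun x => edens eps (u x) (p x) (g x)) =
  pi / 2 * Int (-1) 1 (wint u p g) + eps * areaF u p.
Proof.
have i1 := L1Z (pi / 2) inN_L1_k1; have i2 := L1Z (2 * pi * eps) inN_L1_k2.
have i3 : L1 (-1) 1 (fun x => pi / 2 * k3 (u x) (p x) * g x ^+ 2).
  apply: (@eq_L1 _ _ _ (fun x => pi / 2 * (k3 (u x) (p x) * g x ^+ 2))) => [x _|].
    by rewrite mulrA.
  exact: L1Z inN_L1_k3.
rewrite (IntD (L1D i1 i2) i3) (IntD i1 i2) (IntZ _ inN_L1_k1) (IntZ _ inN_L1_k2).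
have -> : Int (-1) 1 (fun x => pi / 2 * k3 (u x) (p x) * g x ^+ 2) =
    pi / 2 * Int (-1) 1 (fun x => k3 (u x) (p x) * g x ^+ 2).
  by rewrite -(IntZ _ inN_L1_k3); apply: eq_Int => x _; rewrite mulrA.
have -> : areaF u p = 2 * pi * Int (-1) 1 (fun x => k2 (u x) (p x)) by [].
by rewrite Int_wint; ring.
Qed.

Lemma helfrichE eps : helfrichF eps u p g =
  (Int (-1) 1 (fun x => edens eps (u x) (p x) (g x)))%:E.
Proof.
rewrite Int_edens EFinD EFinM /helfrichF /willmoreF; congr (_ * _ + _)%E.
rewrite /Int /Rintegral fineK //; exact: integrable_fin_num inN_L1_wint.
Qed.

End Admissible.
End Energy.

(** * A priori bounds, and Lipschitz dependence of the integrand on (u, u') *)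

Section Bounds.
Variable R : realType.
Implicit Types (alpha eps m M B K L d c x y U P V Q G H : R) (u p g v q h : R -> R).

Definition box m B M U P := m <= U <= B /\ `|P| <= M.

Lemma primitive_upper a b x u p M : a <= x <= b -> L1 a b p -> primitive_on a b u p ->
  (forall y, a <= y <= b -> `|p y| <= M) -> `|u x - u a| <= M * (x - a).
Proof.
move=> /andP[ax xb] pi up pM; rewrite up //.
have pi' := L1S (lexx a) xb pi.
rewrite (le_trans (norm_Int pi')) // -(Int_cst M ax).
apply: le_Int; [exact: L1_norm | exact: L1_cst|].
by move=> y /andP[ay yx]; apply: pM; rewrite ay (le_trans yx).
Qed.

Lemma lipV m x y : 0 < m -> m <= x -> m <= y -> `|x^-1 - y^-1| <= m ^- 2 * `|x - y|.
Proof.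
move=> m0 mx my; have x0 := lt_le_trans m0 mx; have y0 := lt_le_trans m0 my.
have -> : x^-1 - y^-1 = (x^-1 * y^-1) * (y - x) by field; lra.
rewrite normrM distrC ler_wpM2r // gtr0_norm ?mulr_gt0 ?invr_gt0 //.
by rewrite -exprVn expr2 ler_pM ?invr_ge0 ?(ltW x0) ?(ltW y0) // lef_pV2 ?posrE.
Qed.

(* The lower bound integrates (ln u)' = p / u against the bound on the integral of 1 / u. *)
Lemma inN_bounds alpha c : 0 < alpha -> 0 <= c -> c < 1 ->
  exists m B M K : R, [/\ 0 < m, 0 < M, 0 <= K & forall u p g, inN alpha u p g ->
    Int (-1) 1 (wint u p g) <= 8 * c ->
    (forall x, -1 <= x <= 1 -> box m B M (u x) (p x)) /\
    Int (-1) 1 (fun x => g x ^+ 2) <= K].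
Proof.
move=> alpha0 c0 c1.
have c20 : 0 < 1 - c ^+ 2 by rewrite subr_gt0 exprn_ilt1.
pose M := Num.sqrt (1 - c ^+ 2)^-1.
have M0 : 0 < M by rewrite sqrtr_gt0 invr_gt0.
(* From [ds (p y) <= M] come [1 / u <= M * k1] and [|p| <= M], so [|p / u| <= M^2 * k1]; the
   integral of [k1] is at most [8 * c < 8]. Hence [ln u] falls below [ln alpha] by at most
   [8 * M^2]. *)
pose m := alpha * expR (- (8 * M ^+ 2)).
have m0 : 0 < m by rewrite mulr_gt0 ?expR_gt0.
(* The upper bound adds the slope bound times the length 2 of the interval. The last constant comes
   from [k3 >= m / M^5] and the bound [8 * c] on the integral of [k3 * g^2]. *)
exists m, (alpha + M * 2), M, (8 * c * M ^+ 5 / m); split => //.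
  by rewrite divr_ge0 ?(ltW m0) // mulr_ge0 ?exprn_ge0 ?(ltW M0) // mulr_ge0.
move=> u p g uN wle.
have dsM x : -1 <= x <= 1 -> ds (p x) <= M.
  move=> xI; rewrite -(ger0_norm (ltW (ds_gt0 (p x)))) -sqrtr_sqr ler_wsqrtr //.
  apply: ds_slope_le => //.
  by have := slope_le_Int_wint uN xI; rewrite -(ler_pM2l (_ : 0 < 8 :> R)) //; lra.
have pM x : -1 <= x <= 1 -> `|p x| <= M.
  by move=> xI; rewrite (le_trans (norm_le_ds _)) ?dsM.
have k1i := inN_L1_k1 uN; have k3i := inN_L1_k3 uN.
have [k1le k3le] : Int (-1) 1 (fun x => k1 (u x) (p x)) <= 8 * c /\
    Int (-1) 1 (fun x => k3 (u x) (p x) * g x ^+ 2) <= 8 * c.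
  have : 0 <= Int (-1) 1 (fun x => k1 (u x) (p x)).
    apply: Int_ge0 => x xI; rewrite invr_ge0 mulr_ge0 // ltW ?ds_gt0 //.
    exact: inN_gt0 uN _ xI.
  have : 0 <= Int (-1) 1 (fun x => k3 (u x) (p x) * g x ^+ 2).
    apply: Int_ge0 => x xI; rewrite mulr_ge0 ?sqr_ge0 // divr_ge0 ?exprn_ge0 // ltW ?ds_gt0 //.
    exact: inN_gt0 uN _ xI.
  by move: wle; rewrite (Int_wint uN); lra.
have upper x : -1 <= x <= 1 -> u x <= alpha + M * 2.
  move=> xI; have := primitive_upper xI (inN_L1_p uN) (inN_prim_p uN) pM.
  rewrite (inN_uN1 uN) ler_norml => /andP[_ h]; have /andP[x1 x2] := xI.
  by have : M * (x - -1) <= M * 2 by [rewrite ler_wpM2l ?(ltW M0) //; lra]; lra.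
have lower x : -1 <= x <= 1 -> m <= u x.
  move=> xI; have /andP[x1 x2] := xI.
  have N11 : -1 <= 1 :> R by lra.
  (* The minimum [u z] depends on [u]. It serves only to keep the range of [u] away from the
     singularity of [ln] in [chain_rule] and does not enter [m]. *)
  have [z zI umin] := EVT_min N11 (inN_continuous_u uN).
  have {umin} umin y : -1 <= y <= 1 -> u z <= u y by move=> yI; apply: umin; rewrite in_itv.
  have uz0 : 0 < u z by apply: (inN_gt0 uN); move: zI; rewrite in_itv.
  have cV : {within `[-1, 1], continuous (fun y => (u y)^-1)}.
    apply: within_continuousV (inN_continuous_u uN) => y /=; rewrite in_itv /= => yI.
    by rewrite gt_eqF // (inN_gt0 uN).
  have cV' := continuous_itvS (lexx _) x2 cV.
  have xm1 : -1 <= x by [].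
  have pi := L1S (lexx _) x2 (inN_L1_p uN).
  have Vi := continuous_L1 cV'.
  have ch : ln (u x) - ln (u (-1)) = Int (-1) x (fun y => (u y)^-1 * p y).
    apply: (@chain_rule _ (-1) x (u z) (alpha + M * 2) (u z ^- 2) u p (@ln R) (fun y => y^-1)) => //.
    - by rewrite invr_ge0 exprn_ge0 // ltW.
    - apply: continuous_L1; apply: continuous_itvS (lexx _) x2 _.
      exact: within_continuousX (inN_continuous_p uN).
    - exact: primitive_onS (lexx _) x2 (inN_prim_p uN).
    - move=> y /andP[y1 yx]; have yI : -1 <= y <= 1 by rewrite y1 (le_trans yx).
      by rewrite umin // upper.
    - by move=> y /andP[y1 y2]; apply: is_derive1_ln; exact: lt_le_trans y1.
    - by move=> y t /andP[y1 _] /andP[t1 _]; exact: lipV.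
  have e1 : - (8 * M ^+ 2) <= Int (-1) x (fun y => (u y)^-1 * p y).
    have i2 : L1 (-1) 1 (fun y => M * k1 (u y) (p y)) by exact: L1Z.
    have i3 : L1 (-1) 1 (fun y => (- M) * (M * k1 (u y) (p y))) by exact: L1Z.
    have j3 := L1S (lexx _) x2 i3.
    apply: (@le_trans _ _ (Int (-1) x (fun y => (- M) * (M * k1 (u y) (p y))))); last first.
      apply: le_Int => //; first exact: L1M.
      move=> y /andP[y1 yx]; have yI : -1 <= y <= 1 by rewrite y1 (le_trans yx).
      have uy0 : 0 < u y := inN_gt0 uN yI.
      have Vle : (u y)^-1 <= M * k1 (u y) (p y).
        rewrite /k1 invfM mulrCA -[leLHS]mulr1 ler_wpM2l ?invr_ge0 ?(ltW uy0) //.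
        by rewrite ler_pdivlMr ?ds_gt0 // mul1r dsM.
      have V0 : 0 < (u y)^-1 by rewrite invr_gt0.
      have := pM y yI; rewrite ler_norml => /andP[pl _].
      by nra.
    rewrite (IntZ _ (L1S (lexx _) x2 i2)) (IntZ _ (L1S (lexx _) x2 k1i)).
    have : Int (-1) x (fun y => k1 (u y) (p y)) <= Int (-1) 1 (fun y => k1 (u y) (p y)).
      apply: Int_subset => // y yI; rewrite invr_ge0 mulr_ge0 // ltW ?ds_gt0 //.
      exact: inN_gt0 uN _ yI.
    move=> hh; have M2 : 0 <= M ^+ 2 by rewrite sqr_ge0.
    by nra.
  have ux0 := inN_gt0 uN xI.
  rewrite -(lnK ux0) /m -{1}(lnK alpha0) -expRD ler_expR.
  by move: e1; rewrite -ch (inN_uN1 uN); lra.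
split.
  by move=> x xI; split; [rewrite lower ?upper | exact: pM].
rewrite ler_pdivlMr //.
apply: (@le_trans _ _ (M ^+ 5 * (8 * c))); last by rewrite mulrC.
rewrite mulrC -(IntZ _ (inN_L1_sqr uN)) (le_trans _ (_ : M ^+ 5 * Int (-1) 1 (fun x => k3 (u x) (p x) * g x ^+ 2) <= _)) //; last first.
  by rewrite ler_wpM2l // exprn_ge0 // ltW.
rewrite -(IntZ _ k3i); apply: le_Int; [exact: L1Z (inN_L1_sqr uN)|exact: L1Z|].
move=> x xI; rewrite mulrA ler_wpM2r ?sqr_ge0 // /k3 mulrCA -[leLHS]mulr1.
rewrite ler_pM ?(ltW m0) ?lower //.
rewrite ler_pdivlMr ?exprn_gt0 ?ds_gt0 // mul1r lerXn2r ?nnegrE ?(dsM x xI) ?(ltW M0) ?(ltW (ds_gt0 _)) //.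
Qed.

Definition edens0 eps U P := pi / 2 * k1 U P + 2 * pi * eps * k2 U P.
Definition edens2 U P : R := pi / 2 * k3 U P.

Lemma edensE eps U P G : edens eps U P G = edens0 eps U P + edens2 U P * G ^+ 2.
Proof. by []. Qed.

Lemma edens_lip eps m B M : 0 <= eps -> 0 < m -> exists2 L, 0 <= L &
  forall U P V Q, box m B M U P -> box m B M V Q ->
    `|edens0 eps U P - edens0 eps V Q| <= L * (`|U - V| + `|P - Q|) /\
    `|edens2 U P - edens2 V Q| <= L * (`|U - V| + `|P - Q|).
Proof.
move=> eps0 m0; pose B' := Num.max B 0; have B0 : 0 <= B' by rewrite le_max lexx orbT.
(* Lipschitz constants of [k2], [k1] and [k3] on the box. The one for [k1] uses [k2 >= m], the one
   for [k3] that [1 / ds^5] is at most 1 and 5-Lipschitz; [B'] keeps them nonnegative whatever the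
   sign of [B]. *)
pose L2 := ds M + B'; pose L1 := m ^- 2 * L2; pose L3 := 1 + B' * 5.
have L20 : 0 <= L2 by rewrite addr_ge0 // ltW // ds_gt0.
have L10 : 0 <= L1 by rewrite mulr_ge0 // invr_ge0 sqr_ge0.
have L30 : 0 <= L3 by rewrite addr_ge0 // mulr_ge0.
have pi0 : 0 <= pi / 2 :> R by rewrite divr_ge0 // pi_ge0.
have pe0 : 0 <= 2 * pi * eps by rewrite !mulr_ge0 // pi_ge0.
exists (pi / 2 * L1 + 2 * pi * eps * L2 + pi / 2 * L3).
  by rewrite !addr_ge0 // mulr_ge0.
move=> U P V Q [/andP[mU UB] PM] [/andP[mV VB] QM].
set d : R := `|U - V| + `|P - Q|; have d0 : 0 <= d by rewrite addr_ge0.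
have UV : `|U - V| <= d by rewrite lerDl.
have PQ : `|P - Q| <= d by rewrite lerDr.
have VB' : `|V| <= B' by rewrite gtr0_norm ?(lt_le_trans m0) // le_max VB.
have h2 : `|k2 U P - k2 V Q| <= L2 * d.
  have -> : k2 U P - k2 V Q = (U - V) * ds P + V * (ds P - ds Q) by rewrite /k2; ring.
  rewrite (le_trans (ler_normD _ _)) // [leRHS]mulrDl lerD // normrM.
    by rewrite mulrC ler_pM // ger0_norm ?ds_le // ltW // ds_gt0.
  by rewrite ler_pM // (le_trans (ds_lip _ _)).
have h1 : `|k1 U P - k1 V Q| <= L1 * d.
  have mk W T : m <= W -> m <= k2 W T.
    move=> mW; rewrite /k2 -[leLHS]mulr1 ler_pM ?ds_ge1 // ltW //.
  rewrite (le_trans (lipV m0 (mk _ _ mU) (mk _ _ mV))) // /L1 -mulrA ler_wpM2l //.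
  by rewrite invr_ge0 sqr_ge0.
have h3 : `|k3 U P - k3 V Q| <= L3 * d.
  have -> : k3 U P - k3 V Q = (U - V) * ds P ^- 5 + V * (ds P ^- 5 - ds Q ^- 5).
    by rewrite /k3; ring.
  rewrite (le_trans (ler_normD _ _)) // [leRHS]mulrDl lerD // normrM.
    rewrite mulrC ler_pM // -exprVn.
    have /andP[i0 i1] := dsV_bounds P.
    by rewrite ger0_norm ?exprn_ge0 // exprn_ile1.
  rewrite -mulrA ler_pM // (le_trans (dsVX_lip _ _ _)) // ler_wpM2l //.
have e1 : 0 <= pi / 2 * (L1 * d) by apply: mulr_ge0 => //; exact: mulr_ge0.
have e2 : 0 <= 2 * pi * eps * (L2 * d) by apply: mulr_ge0 => //; exact: mulr_ge0.
have e3 : 0 <= pi / 2 * (L3 * d) by apply: mulr_ge0 => //; exact: mulr_ge0.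
split.
  rewrite /edens0.
  have -> : pi / 2 * k1 U P + 2 * pi * eps * k2 U P - (pi / 2 * k1 V Q + 2 * pi * eps * k2 V Q)
    = pi / 2 * (k1 U P - k1 V Q) + 2 * pi * eps * (k2 U P - k2 V Q) by ring.
  rewrite (le_trans (ler_normD _ _)) //.
  rewrite [`|pi / 2 * _|]normrM [`|2 * pi * eps * _|]normrM (ger0_norm pi0) (ger0_norm pe0).
  apply: (@le_trans _ _ (pi / 2 * (L1 * d) + 2 * pi * eps * (L2 * d))).
    by rewrite lerD // ler_wpM2l.
  by lra.
rewrite /edens2 -mulrBr normrM (ger0_norm pi0).
apply: (@le_trans _ _ (pi / 2 * (L3 * d))); first by rewrite ler_wpM2l.
by lra.
Qed.

End Bounds.

(** * Midpoints of admissible functions and the convexity defect *)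

Section Midpoint.
Variable R : realType.
Implicit Types (alpha eps m B M K L d x y U P V Q G H : R) (u p g v q h : R -> R).

Definition mid f1 f2 x : R := (f1 x + f2 x) / 2.

Lemma L1_mid a b f1 f2 : L1 a b f1 -> L1 a b f2 -> L1 a b (mid f1 f2).
Proof.
move=> i1 i2; apply: (@eq_L1 _ _ _ (fun x => 2^-1 * (f1 x + f2 x))) => [x _|].
  by rewrite mulrC.
exact/L1Z/L1D.
Qed.

Lemma Int_mid a b f1 f2 : L1 a b f1 -> L1 a b f2 ->
  Int a b (mid f1 f2) = (Int a b f1 + Int a b f2) / 2.
Proof.
move=> i1 i2; rewrite (@eq_Int _ _ _ _ (fun x => 2^-1 * (f1 x + f2 x))) => [|x _].
  by rewrite (IntZ _ (L1D i1 i2)) IntD // mulrC.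
by rewrite mulrC.
Qed.

Lemma L1_sqr_mid a b f1 f2 : L1 a b f1 -> L1 a b f2 ->
  L1 a b (fun x => f1 x ^+ 2) -> L1 a b (fun x => f2 x ^+ 2) ->
  L1 a b (fun x => mid f1 f2 x ^+ 2) /\ L1 a b (fun x => (f1 x - f2 x) ^+ 2).
Proof.
move=> i1 i2 s1 s2.
have si : L1 a b (fun x => 2 * (f1 x ^+ 2 + f2 x ^+ 2)) by exact/L1Z/L1D.
split; apply: (L1_le _ _ si).
- by apply: measurable_funX; exact: L1_measurable (L1_mid i1 i2).
- move=> x _; rewrite ger0_norm ?sqr_ge0 // /mid.
  have := sqr_ge0 (f1 x - f2 x); have := sqr_ge0 (f1 x); have := sqr_ge0 (f2 x); nra.
- by apply: measurable_funX; exact: L1_measurable (L1B i1 i2).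
- move=> x _; rewrite ger0_norm ?sqr_ge0 //.
  have := sqr_ge0 (f1 x + f2 x); nra.
Qed.

Lemma inN_mid alpha u p g v q h : inN alpha u p g -> inN alpha v q h ->
  inN alpha (mid u v) (mid p q) (mid g h).
Proof.
move=> uN vN; have := conj uN vN.
have gi := inN_L1 uN; have hi := inN_L1 vN.
have pi := inN_L1_p uN; have qi := inN_L1_p vN.
have prim (f1 f2 d1 d2 : R -> R) x : L1 (-1) 1 d1 -> L1 (-1) 1 d2 -> -1 <= x <= 1 ->
    f1 x = f1 (-1) + Int (-1) x d1 -> f2 x = f2 (-1) + Int (-1) x d2 ->
    mid f1 f2 x = mid f1 f2 (-1) + Int (-1) x (mid d1 d2).
  move=> i1 i2 /andP[x1 x2] e1 e2; rewrite Int_mid; [|exact: L1S i1|exact: L1S i2].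
  by rewrite /mid e1 e2; field.
case=> -[[_ _ _ pE uE] ue u0 [uN1 u1] [pN1 p1]] [[_ _ _ qE vE] ve v0 [vN1 v1] [qN1 q1]].
have itvI x : I11 x -> -1 <= x <= 1 by rewrite /I11 /= in_itv.
split.
- split.
  + exact: L1_measurable (L1_mid gi hi).
  + exact: L1_mid.
  + exact: (L1_sqr_mid gi hi (inN_L1_sqr uN) (inN_L1_sqr vN)).1.
  + by move=> x xI; apply: prim; [..|exact: pE|exact: qE] => //; exact: itvI.
  + by move=> x xI; apply: prim; [..|exact: uE|exact: vE] => //; exact: itvI.
- by move=> x xI; rewrite /mid ue ?ve.
- by move=> x xI; rewrite /mid divr_gt0 // addr_gt0 ?u0 ?v0.
- by rewrite /mid uN1 vN1 u1 v1; split; field.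
- by rewrite /mid pN1 qN1 p1 q1; split; field.
Qed.

Lemma box_mid m B M U P V Q : box m B M U P -> box m B M V Q ->
  box m B M ((U + V) / 2) ((P + Q) / 2).
Proof.
move=> [/andP[mU UB] PM] [/andP[mV VB] QM]; split; first by apply/andP; split; lra.
by move: PM QM; rewrite !ler_norml => /andP[? ?] /andP[? ?]; apply/andP; split; lra.
Qed.

(** Uniform ellipticity: this constant is the gain in the midpoint inequality that controls the
    distance of second derivatives. *)
Lemma edens2_ge m B M U P : 0 < m -> box m B M U P -> pi / 2 * (m / ds M ^+ 5) <= edens2 U P.
Proof.
move=> m0 [/andP[mU _] PM]; rewrite ler_wpM2l ?divr_ge0 ?pi_ge0 //.
rewrite ler_pM ?(ltW m0) // ?invr_ge0 ?exprn_ge0 ?(ltW (ds_gt0 _)) //.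
rewrite lef_pV2 ?posrE ?exprn_gt0 ?ds_gt0 //.
by rewrite lerXn2r ?nnegrE ?(ltW (ds_gt0 _)) // ds_le.
Qed.

Section Pointwise.
Variables (eps m B M L : R).
Hypotheses (m0 : 0 < m) (L0 : 0 <= L).
Hypothesis lip : forall U P V Q, box m B M U P -> box m B M V Q ->
  `|edens0 eps U P - edens0 eps V Q| <= L * (`|U - V| + `|P - Q|) /\
  `|edens2 U P - edens2 V Q| <= L * (`|U - V| + `|P - Q|).

(* The identity ((G + H)/2)^2 + ((G - H)/2)^2 = (G^2 + H^2)/2 turns the failure of
   convexity in (U, P), of size d, into a bound on (G - H)^2. *)
Lemma edens_mid U P V Q G H d : box m B M U P -> box m B M V Q ->
  `|U - V| + `|P - Q| <= d ->
  edens eps ((U + V) / 2) ((P + Q) / 2) ((G + H) / 2) +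
    pi / 2 * (m / ds M ^+ 5) / 4 * (G - H) ^+ 2 <=
  (edens eps U P G + edens eps V Q H) / 2 + L * d * (1 + (G ^+ 2 + H ^+ 2) / 2).
Proof.
move=> bU bV dUV; have bm := box_mid bU bV; rewrite !edensE.
have a0 := edens2_ge m0 bm.
have [d1 e1] := lip bm bU; have [d2 e2] := lip bm bV.
have half x y : `|(x + y) / 2 - x| <= `|x - y| /\ `|(x + y) / 2 - y| <= `|x - y|.
  have -> : (x + y) / 2 - x = - ((x - y) / 2) by field.
  have -> : (x + y) / 2 - y = (x - y) / 2 by field.
  rewrite normrN normrM (ger0_norm (_ : 0 <= 2^-1)) //.
  by have := normr_ge0 (x - y); split; lra.
have [u1 u2] := half U V; have [p1 p2] := half P Q.
have w1 : L * (`|(U + V) / 2 - U| + `|(P + Q) / 2 - P|) <= L * d by rewrite ler_wpM2l //; lra.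
have w2 : L * (`|(U + V) / 2 - V| + `|(P + Q) / 2 - Q|) <= L * d by rewrite ler_wpM2l //; lra.
have {d1} d1 := le_trans d1 w1; have {d2} d2 := le_trans d2 w2.
have {e1} e1 := le_trans e1 w1; have {e2} e2 := le_trans e2 w2.
move: d1 d2 e1 e2 a0; rewrite !ler_norml.
move: (edens0 _ _ _) (edens0 _ _ _) (edens0 _ _ _) (edens2 _ _) (edens2 _ _) (edens2 _ _) => Z Y X c b a.
move: (L * d) (pi / 2 * _) => D k /andP[_ d1] /andP[_ d2] /andP[_ e1] /andP[_ e2] ka.
have G2 := sqr_ge0 G; have H2 := sqr_ge0 H; have GH := sqr_ge0 (G - H).
have t1 : a * G ^+ 2 <= (b + D) * G ^+ 2 by rewrite ler_wpM2r //; lra.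
have t2 : a * H ^+ 2 <= (c + D) * H ^+ 2 by rewrite ler_wpM2r //; lra.
have t3 : k * (G - H) ^+ 2 <= a * (G - H) ^+ 2 by rewrite ler_wpM2r //; lra.
have -> : a * ((G + H) / 2) ^+ 2 = (a * G ^+ 2 + a * H ^+ 2) / 2 - a * (G - H) ^+ 2 / 4 by field.
by move: t1 t2 t3; rewrite !mulrDl; lra.
Qed.

(** In the error factor, 2 is the length of the interval and [K] bounds the mean of the integrals of
    [g^2] and [h^2]. *)
Lemma Int_edens_mid alpha K d u p g v q h :
  inN alpha u p g -> inN alpha v q h ->
  (forall x, -1 <= x <= 1 -> box m B M (u x) (p x)) ->
  (forall x, -1 <= x <= 1 -> box m B M (v x) (q x)) ->
  Int (-1) 1 (fun x => g x ^+ 2) <= K -> Int (-1) 1 (fun x => h x ^+ 2) <= K ->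
  0 <= d -> (forall x, -1 <= x <= 1 -> `|u x - v x| + `|p x - q x| <= d) ->
  Int (-1) 1 (fun x => edens eps (mid u v x) (mid p q x) (mid g h x)) +
    pi / 2 * (m / ds M ^+ 5) / 4 * Int (-1) 1 (fun x => (g x - h x) ^+ 2) <=
  (Int (-1) 1 (fun x => edens eps (u x) (p x) (g x)) +
   Int (-1) 1 (fun x => edens eps (v x) (q x) (h x))) / 2 + L * d * (2 + K).
Proof.
move=> uN vN bu bv gK hK d0 dist; have wN := inN_mid uN vN.
have i0 := inN_L1_edens wN eps; have i1 := inN_L1_edens uN eps; have i2 := inN_L1_edens vN eps.
have g2 := inN_L1_sqr uN; have h2 := inN_L1_sqr vN.
have [_ gh2] := L1_sqr_mid (inN_L1 uN) (inN_L1 vN) g2 h2.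
set k := pi / 2 * _ / 4.
have ki := L1Z k gh2.
pose rhs x := mid (fun x => edens eps (u x) (p x) (g x)) (fun x => edens eps (v x) (q x) (h x)) x +
  L * d * (1 + mid (fun x => g x ^+ 2) (fun x => h x ^+ 2) x).
have m1 := L1_mid i1 i2; have m2 := L1_mid g2 h2.
have c1 : L1 (-1) 1 (fun x => 1 + mid (fun x => g x ^+ 2) (fun x => h x ^+ 2) x).
  by apply: L1D m2; exact: L1_cst.
have ri : L1 (-1) 1 rhs by apply: L1D => //; exact: L1Z.
have N11 : -1 <= 1 :> R by lra.
rewrite -(IntZ _ gh2) -(IntD i0 ki); apply: (@le_trans _ _ (Int (-1) 1 rhs)).
  apply: le_Int => //; first exact: L1D.
  by move=> x xI; exact: (edens_mid _ _ (bu x xI) (bv x xI) (dist x xI)).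
rewrite (IntD m1 (L1Z _ c1)) (IntZ _ c1) (Int_mid i1 i2) lerD2l.
rewrite ler_wpM2l ?mulr_ge0 // (IntD (L1_cst _ _ 1) m2) (Int_mid g2 h2) (Int_cst _ N11).
lra.
Qed.

End Pointwise.
End Midpoint.

(** * Completeness of L^1 with almost everywhere convergence, and Fatou's lemma *)

Section Limit.
Variable R : realType.
Local Notation mu := (@lebesgue_measure R).
Implicit Types (alpha eps a b m B M K L d x y : R) (u p g v q h : R -> R).

Lemma ae_imp (P Q : R -> Prop) : (forall x, P x -> Q x) ->
  {ae mu, forall x, P x} -> {ae mu, forall x, Q x}.
Proof.
move=> PQ [A [mA A0 PA]]; exists A; split => //.
by apply: subset_trans PA; apply: subsetC.
Qed.

Lemma Int_EFin a b f : L1 a b f -> (\int[mu]_(x in `[a, b]) (f x)%:E)%E = (Int a b f)%:E.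
Proof. by move=> fi; rewrite /Int /Rintegral fineK //; exact: integrable_fin_num fi. Qed.

(** The Riesz-Fischer argument: the series [S] of absolute increments has integral at most 1, hence
    is finite almost everywhere, and there the telescoping series converges absolutely. [|g_0| + S]
    dominates the whole sequence. *)
Lemma L1_fast_cvg a b (g_ : nat -> R -> R) : (forall n, L1 a b (g_ n)) ->
  (forall n, Int a b (fun x => `|g_ n.+1 x - g_ n x|) <= 2 ^- n.+1) ->
  exists g, [/\ L1 a b g, Int a b (fun x => `|g_ n x - g x|) @[n --> \oo] --> 0 &
    {ae mu, forall x, `[a, b]%classic x -> g_ n x @[n --> \oo] --> g x}].
Proof.
move=> gi gfast.
have mab := measurable_cc a b.
have di n : L1 a b (fun x => `|g_ n.+1 x - g_ n x|) by exact/L1_norm/L1B.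
pose D n x : \bar R := (`|g_ n.+1 x - g_ n x|)%:E.
have D0 n x : (0 <= D n x)%E by rewrite lee_fin.
have mD n : measurable_fun `[a, b] (D n) by apply/measurable_EFinP; exact: L1_measurable.
pose S x : \bar R := (\sum_(0 <= k <oo) D k x)%E.
have S0 x : (0 <= S x)%E by apply: nneseries_ge0.
have mS : measurable_fun `[a, b] S.
  apply: (@eq_measurable_fun _ _ _ _ _ (fun x => \sum_(0 <= k <oo | k \in predT) D k x)%E).
    by move=> x _; rewrite /S; apply: eq_eseriesl.
  exact: ge0_emeasurable_sum.
have Si : mu.-integrable `[a, b] S.
  apply/integrableP; split => //.
  have -> : (\int[mu]_(x in `[a, b]) `|S x| = \int[mu]_(x in `[a, b]) S x)%E.
    by apply: eq_integral => x _; rewrite gee0_abs.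
  have -> : (\int[mu]_(x in `[a, b]) S x = \sum_(0 <= k <oo) \int[mu]_(x in `[a, b]) D k x)%E.
    exact: integral_nneseries.
  apply: (@le_lt_trans _ _ 1%E); last exact: ltry.
  apply: lime_le.
    by apply: is_cvg_nneseries => n _ _; apply: integral_ge0 => x _; exact: D0.
  apply: nearW => n; apply: (@le_trans _ _ (1 - 2 ^- n)%:E); last first.
    by rewrite lee_fin gerBl // invr_ge0 exprn_ge0.
  elim: n => [|n IH]; first by rewrite big_geq // expr0 invr1 subrr.
  rewrite big_nat_recr //= (le_trans (leeD IH (_ : _ <= (2 ^- n.+1)%:E)%E)) //.
    by rewrite Int_EFin // lee_fin gfast.
  rewrite -EFinD lee_fin le_eqVlt; apply/orP; left; apply/eqP.
  by rewrite exprS; field; rewrite expf_neq0.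
have norm_le n x : (`|(g_ n x)%:E| <= `|g_ 0%N x|%:E + S x)%E.
  apply: (@le_trans _ _ (`|g_ 0%N x|%:E + \sum_(0 <= k < n) D k x)%E); last first.
    by rewrite leeD2l // nneseries_lim_ge.
  rewrite sumEFin -EFinD lee_fin.
  elim: n => [|n IH]; first by rewrite big_geq // addr0.
  rewrite big_nat_recr //= addrA -[X in `|X|](subrK (g_ n x)) addrC.
  by rewrite (le_trans (ler_normD _ _)) // lerD.
(* The upper limit is measurable on the whole interval, including the null set where the sequence
   may diverge, and equals the limit elsewhere. *)
pose g x := fine (limn_esup (fun n => (g_ n x)%:E)).
have mg : measurable_fun `[a, b] g.
  apply: measurableT_comp; first exact: fine_measurable.
  by apply: measurable_fun_limn_esup => n; apply/measurable_EFinP; exact: L1_measurable.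
have g_cvg : {ae mu, forall x, `[a, b]%classic x -> g_ n x @[n --> \oo] --> g x}.
  have := integrable_ae mab Si; apply: ae_imp => x Sfin xab.
  have {Sfin} Sfin := Sfin xab.
  have cv : cvgn (g_ ^~ x).
    have -> : g_ ^~ x = fun n => g_ 0%N x + series (telescope (g_ ^~ x)) n.
      by apply/funext => n; rewrite -eq_sum_telescope.
    apply: is_cvgD; first exact: is_cvg_cst.
    apply: normed_cvg; apply: nondecreasing_is_cvgn.
      by apply: nondecreasing_series => n _ _; exact: normr_ge0.
    exists (fine (S x)) => _ [n _ <-].
    by rewrite -lee_fin fineK // /series /= -sumEFin nneseries_lim_ge.
  rewrite /g (@is_cvg_limn_esupE _ (fun n => (g_ n x)%:E)).
    by rewrite EFin_lim.
  by apply: (cvgP (limn (g_ ^~ x))%:E); apply: cvg_EFin => //; exact: nearW.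
exists g.
have mgn n : measurable_fun `[a, b] (fun x => (g_ n x)%:E).
  by apply/measurable_EFinP; exact: L1_measurable.
have mEg : measurable_fun `[a, b] (fun x => (g x)%:E) by exact/measurable_EFinP.
have gE_cvg : {ae mu, forall x, `[a, b]%classic x -> (g_ n x)%:E @[n --> \oo] --> (g x)%:E}.
  move: g_cvg; apply: ae_imp => x h /h hx.
  by apply: cvg_EFin => //; exact: nearW.
have domi : mu.-integrable `[a, b] (fun x => `|g_ 0%N x|%:E + S x)%E.
  by apply: integrableD => //; exact: L1_norm (gi 0%N).
have dom : {ae mu, forall x, forall n, `[a, b]%classic x ->
    (`|(g_ n x)%:E| <= `|g_ 0%N x|%:E + S x)%E}.
  by apply: aeW => x n _; exact: norm_le.
have [gi' h _] := dominated_convergence mab mgn mEg gE_cvg domi dom.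
split => //.
have -> : (fun n => Int a b (fun x => `|g_ n x - g x|)) =
    fine \o (fun n => \int[mu]_(x in `[a, b]) `|(g_ n x)%:E - (g x)%:E|)%E.
  by apply/funext => n.
exact: fine_cvg.
Qed.

(** The integrals are bounded only eventually and up to [e], which is what a minimising sequence
    provides. *)
Lemma fatou_Int a b (f_ : nat -> R -> R) (f : R -> R) (I : R) : (forall n, L1 a b (f_ n)) ->
  measurable_fun `[a, b] f ->
  (forall n x, a <= x <= b -> 0 <= f_ n x) -> (forall x, a <= x <= b -> 0 <= f x) ->
  {ae mu, forall x, `[a, b]%classic x -> f_ n x @[n --> \oo] --> f x} ->
  (forall e, 0 < e -> \forall n \near \oo, Int a b (f_ n) <= I + e) ->
  L1 a b f /\ Int a b f <= I.
Proof.
move=> fi mf f_0 f0 f_cvg fI; have mab := measurable_cc a b.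
have itvE x : `[a, b]%classic x -> a <= x <= b by rewrite /= in_itv.
have mfn n : measurable_fun `[a, b] (fun x => (f_ n x)%:E).
  by apply/measurable_EFinP; exact: L1_measurable.
have mE : measurable_fun `[a, b] (fun x => (f x)%:E) by exact/measurable_EFinP.
have le : (\int[mu]_(x in `[a, b]) (f x)%:E <= I%:E)%E.
  have -> : (\int[mu]_(x in `[a, b]) (f x)%:E =
      \int[mu]_(x in `[a, b]) limn_einf (fun n => (f_ n x)%:E))%E.
    apply: ae_eq_integral => //.
      rewrite /limn_einf; apply: measurableT_comp => //; apply: measurable_fun_limn_esup => n.
      apply/(@measurable_EFinP _ _ _ _ (fun x => - f_ n x)).
      by apply: measurableT_comp => //; exact: L1_measurable.
    move: f_cvg; apply: ae_imp => x h /h hx.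
    have hE : (f_ n x)%:E @[n --> \oo] --> (f x)%:E by apply: cvg_EFin => //; exact: nearW.
    by rewrite (cvg_limn_einf_sup hE).1.
  have f_0' n x : `[a, b]%classic x -> (0 <= (f_ n x)%:E)%E.
    by move=> /itvE xab; rewrite lee_fin f_0.
  apply: (le_trans (fatou _ mab mfn f_0')).
  apply/lee_addgt0Pr => e e0; rewrite -EFinD limn_einf_lim.
  apply: lime_le; first exact: is_cvg_einfs.
  move: (fI e e0); apply: filterS => n fnI.
  apply: (@le_trans _ _ (\int[mu]_(x in `[a, b]) (f_ n x)%:E)%E).
    by apply: ereal_inf_lbound; exists n => /=.
  by rewrite Int_EFin // lee_fin.
have fi' : L1 a b f.
  apply/integrableP; split => //.
  have -> : (\int[mu]_(x in `[a, b]) `|(EFin \o f) x| = \int[mu]_(x in `[a, b]) (f x)%:E)%E.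
    by apply: eq_integral => x; rewrite inE => /itvE xab; rewrite /= ger0_norm // f0.
  by rewrite (le_lt_trans le) // ltry.
by split => //; rewrite -lee_fin -Int_EFin.
Qed.

End Limit.

(** * Passing to the limit in the constraints and in the energy *)

Section LimitAdmissible.
Variable R : realType.
Implicit Types (alpha eps a b m B M K L d x y : R) (u p g v q h : R -> R).

Lemma cvg_dist_le (f_ d_ : nat -> R) (l : R) : (forall n, `|f_ n - l| <= d_ n) ->
  d_ n @[n --> \oo] --> 0 -> f_ n @[n --> \oo] --> l.
Proof.
move=> fd d0; apply/cvgrPdist_le => e e0.
move/cvgrPdist_le: d0 => /(_ _ e0); apply: filterS => n; rewrite sub0r normrN => de.
by rewrite distrC (le_trans (fd n)) // (le_trans _ de) // ler_norm.
Qed.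

Lemma cvg_expr n (f_ : nat -> R) (l : R) : f_ k @[k --> \oo] --> l ->
  f_ k ^+ n @[k --> \oo] --> l ^+ n.
Proof.
move=> fl; apply: (@continuous_cvg _ _ _ _ _ f_ (fun z => z ^+ n)) => //.
exact: exprn_continuous.
Qed.

Lemma edens_ge0 eps U P G : 0 <= eps -> 0 < U -> 0 <= edens eps U P G.
Proof.
move=> eps0 U0; have s0 := ltW (ds_gt0 P); have pi0 := @pi_ge0 R.
have U0' := ltW U0; have k20 : 0 <= k2 U P by exact: mulr_ge0.
have h0 : 0 <= pi / 2 :> R by rewrite divr_ge0.
apply: addr_ge0; first apply: addr_ge0.
- by rewrite mulr_ge0 // invr_ge0.
- by rewrite !mulr_ge0.
- by rewrite mulr_ge0 ?sqr_ge0 // mulr_ge0 // divr_ge0 // exprn_ge0.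
Qed.

Lemma cvg_edens eps (U_ P_ G_ : nat -> R) U P G : U != 0 ->
  U_ n @[n --> \oo] --> U -> P_ n @[n --> \oo] --> P -> G_ n @[n --> \oo] --> G ->
  edens eps (U_ n) (P_ n) (G_ n) @[n --> \oo] --> edens eps U P G.
Proof.
move=> U0 cU cP cG.
have cd : ds (P_ n) @[n --> \oo] --> ds P by apply: continuous_cvg cP; exact: continuous_ds.
have c2 : k2 (U_ n) (P_ n) @[n --> \oo] --> k2 U P by exact: cvgM.
have d0 := ds_neq0 P.
apply: cvgD; first apply: cvgD.
- apply: cvgM; first exact: cvg_cst.
  by apply: cvgV => //; rewrite mulf_neq0.
- by apply: cvgM => //; exact: cvg_cst.
- apply: cvgM; last exact: cvg_expr.
  apply: cvgM; first exact: cvg_cst.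
  apply: cvgM => //; apply: cvgV; first by rewrite expf_neq0.
  exact: cvg_expr.
Qed.

(** L^1 convergence of second derivatives gives uniform convergence of the slopes, then of the
    functions, since all members share their values at -1. The lower bound [m] keeps the limit
    positive, hence the integrand continuous at it. *)
Lemma inN_limit alpha eps m K I (u_ p_ g_ : nat -> R -> R) : 0 <= eps -> 0 < m ->
  (forall n, inN alpha (u_ n) (p_ n) (g_ n)) ->
  (forall n x, -1 <= x <= 1 -> m <= u_ n x) ->
  (forall n, Int (-1) 1 (fun x => g_ n x ^+ 2) <= K) ->
  (forall n, Int (-1) 1 (fun x => `|g_ n.+1 x - g_ n x|) <= 2 ^- n.+1) ->
  (forall e, 0 < e -> \forall n \near \oo,
    Int (-1) 1 (fun x => edens eps (u_ n x) (p_ n x) (g_ n x)) <= I + e) ->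
  exists u p g, inN alpha u p g /\ Int (-1) 1 (fun x => edens eps (u x) (p x) (g x)) <= I.
Proof.
move=> eps0 m0 uN um gK fast EI.
have gi n := inN_L1 (uN n); have pi n := inN_L1_p (uN n).
have [g [gi0 d0 g_cvg]] := L1_fast_cvg gi fast.
set d_ := fun n => _ in d0.
have N11 : -1 <= 1 :> R by lra.
(* The conditions at -1 hold by construction; those at 1 and evenness are inherited from the
   sequence by pointwise convergence. *)
pose p x := Int (-1) x g; pose u x := alpha + Int (-1) x p.
have pc : {within `[-1, 1], continuous p} by exact: continuous_Int.
have pi0 := continuous_L1 pc.
have p_dist n x : -1 <= x <= 1 -> `|p_ n x - p x| <= d_ n.
  move=> /andP[x1 x2]; have i1 := L1S (lexx _) x2 (gi n); have i2 := L1S (lexx _) x2 gi0.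
  have -> : p_ n x - p x = Int (-1) x (fun t => g_ n t - g t).
    by rewrite IntB // -(inN_prim_g (uN n)) // (inN_pN1 (uN n)) subr0.
  rewrite (le_trans (norm_Int (L1B i1 i2))) //.
  by apply: Int_subset => //; exact/L1_norm/L1B.
have dn0 n : 0 <= d_ n by apply: Int_ge0.
have u_dist n x : -1 <= x <= 1 -> `|u_ n x - u x| <= 2 * d_ n.
  move=> /andP[x1 x2]; have i1 := L1S (lexx _) x2 (pi n); have i2 := L1S (lexx _) x2 pi0.
  have -> : u_ n x - u x = Int (-1) x (fun t => p_ n t - p t).
    by rewrite IntB // -(inN_prim_p (uN n)) // (inN_uN1 (uN n)) /u; ring.
  rewrite (le_trans (norm_Int (L1B i1 i2))) //.
  apply: (@le_trans _ _ (Int (-1) x (cst (d_ n)))).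
    apply: le_Int; [exact/L1_norm/L1B|exact: L1_cst|move=> t /andP[t1 tx]].
    by rewrite p_dist // t1 (le_trans tx).
  by rewrite Int_cst // mulrC ler_wpM2r //; lra.
have d20 : 2 * d_ n @[n --> \oo] --> 0 by rewrite -(mulr0 2); apply: cvgM => //; exact: cvg_cst.
have p_cvg x : -1 <= x <= 1 -> p_ n x @[n --> \oo] --> p x.
  by move=> xI; apply: cvg_dist_le d0 => n; exact: p_dist.
have u_cvg x : -1 <= x <= 1 -> u_ n x @[n --> \oo] --> u x.
  by move=> xI; apply: cvg_dist_le d20 => n; exact: u_dist.
have mg := L1_measurable gi0.
have itvE x : `[-1, 1]%classic x -> -1 <= x <= 1 by rewrite /= in_itv.
(* The sequence converges in L^1 only; square integrability of the limit comes from Fatou's lemma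
   and the uniform bound [K]. *)
have [g2i _] : L1 (-1) 1 (fun x => g x ^+ 2) /\ Int (-1) 1 (fun x => g x ^+ 2) <= K.
  apply: (@fatou_Int _ _ _ (fun n x => g_ n x ^+ 2)).
  - by move=> n; exact: inN_L1_sqr (uN n).
  - exact: measurable_funX.
  - by move=> *; exact: sqr_ge0.
  - by move=> *; exact: sqr_ge0.
  - move: g_cvg; apply: ae_imp => x h /h hx.
    exact: cvg_expr.
  - by move=> e e0; apply: nearW => n; rewrite (le_trans (gK n)) // lerDl ltW.
have uge x : -1 <= x <= 1 -> m <= u x.
  by move=> xI; apply: (cvgr_to_ge (u_cvg x xI)); apply: nearW => n; exact: um.
have lim_eq (f_ : nat -> R) (l1 l2 : R) : f_ n @[n --> \oo] --> l1 -> f_ n @[n --> \oo] --> l2 -> l1 = l2.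
  by move=> h1 h2; exact: (cvg_unique (@norm_hausdorff _ R) h1 h2).
have N : inN alpha u p g.
  split.
  - by split => // x _; rewrite /u /p Int_xx ?addr0 ?add0r.
  - move=> x /itvE xI; apply: (lim_eq (u_ ^~ x)); last exact: u_cvg.
    rewrite (_ : u_ ^~ x = u_ ^~ (- x)); first by apply: u_cvg; lra.
    by apply/funext => n; rewrite (inN_even (uN n)).
  - by move=> x /itvE xI; rewrite (lt_le_trans m0) ?uge.
  - split; first by rewrite /u Int_xx addr0.
    apply: (lim_eq (u_ ^~ 1)); first by apply: u_cvg; rewrite lexx N11.
    by rewrite (_ : u_ ^~ 1 = cst alpha); [exact: cvg_cst|apply/funext => n; exact: inN_u1 (uN n)].
  - split; first by rewrite /p Int_xx.
    apply: (lim_eq (p_ ^~ 1)); first by apply: p_cvg; rewrite lexx N11.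
    by rewrite (_ : p_ ^~ 1 = cst 0); [exact: cvg_cst|apply/funext => n; exact: inN_p1 (uN n)].
exists u, p, g; split => //.
suff [] : L1 (-1) 1 (fun x => edens eps (u x) (p x) (g x)) /\
  Int (-1) 1 (fun x => edens eps (u x) (p x) (g x)) <= I by [].
apply: (@fatou_Int _ _ _ (fun n x => edens eps (u_ n x) (p_ n x) (g_ n x)) _ _ _ _ _ _ _ EI).
- by move=> n; exact: inN_L1_edens (uN n) eps.
- exact: L1_measurable (inN_L1_edens N eps).
- by move=> n x xI; apply: edens_ge0 => //; exact: inN_gt0 (uN n) _ xI.
- by move=> x xI; apply: edens_ge0 => //; exact: inN_gt0 N _ xI.
- move: g_cvg; apply: ae_imp => x h xI; have /itvE xI' := xI.
  by apply: cvg_edens; [rewrite gt_eqF // (inN_gt0 N)|exact: u_cvg|exact: p_cvg|exact: h].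
Qed.

End LimitAdmissible.

(** * The direct method along an ultrafilter *)

Section DirectMethod.
Variable R : realType.
Local Notation T := ((R -> R) * (R -> R) * (R -> R))%type.
Implicit Types (alpha eps m B M K I x y e : R) (z w : T).

(* A point z : T stands for the triple (u, u', u''). *)
Definition energy eps z := Int (-1) 1 (fun x => edens eps (z.1.1 x) (z.1.2 x) (z.2 x)).

(** The constants do not depend on the triple: [K] gives equicontinuity of the slopes and the box a
    common Lipschitz constant of the integrand. *)
Definition tame alpha m B M K : set T := [set z | [/\ inN alpha z.1.1 z.1.2 z.2,
  forall x, -1 <= x <= 1 -> box m B M (z.1.1 x) (z.1.2 x) &
  Int (-1) 1 (fun x => z.2 x ^+ 2) <= K]].

Section Selection.
Variables (alpha eps m B M K I : R).
Hypotheses (eps0 : 0 <= eps) (m0 : 0 < m) (K0 : 0 <= K).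
Hypothesis I_le : forall z, inN alpha z.1.1 z.1.2 z.2 -> I <= energy eps z.
Variable UF : set_system T.
Hypothesis UF_ultra : UltraFilter UF.
Hypothesis UF_min : forall e, 0 < e -> UF [set z | tame alpha m B M K z /\ energy eps z < I + e].

Let UF_proper : ProperFilter UF. Proof. exact: ultra_proper. Qed.
Let UF_filter : Filter UF. Proof. exact: filter_filter. Qed.

Let UF_tame : UF (tame alpha m B M K).
Proof. by apply: filterS (UF_min ltr01) => z []. Qed.

(** The slopes at [x] lie in the compact interval [-M, M] and so cluster at some [r]. Of the set of
    triples with slope within [e / 2] of [r] and its complement, one belongs to the ultrafilter; the
    complement would contradict clustering. No subsequence has to be extracted. *)
Lemma ultra_slope_pointwise x e : -1 <= x <= 1 -> 0 < e ->
  exists2 A, UF A & forall z w, A z -> A w -> `|z.1.2 x - w.1.2 x| <= e.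
Proof.
move=> xI e0; pose F : set_system R := (fun z : T => z.1.2 x) @ UF.
have FM : F `[- M, M]%classic.
  have : UF [set z : T | `[- M, M]%classic (z.1.2 x)] by
    apply: filterS UF_tame => z [_ bz _]; rewrite /= in_itv /= -ler_norml (bz x xI).2.
  by [].
have [r [_ rF]] := segment_compact (fmap_proper_filter _ UF_proper : ProperFilter F) FM.
pose A := [set z : T | `|z.1.2 x - r| <= e / 2].
have [UA|UnA] := in_ultra_setVsetC A UF_ultra.
  exists A => // z w; rewrite /A /= => zr wr.
  have -> : z.1.2 x - w.1.2 x = (z.1.2 x - r) - (w.1.2 x - r) by ring.
  by rewrite (le_trans (ler_normB _ _)) //; lra.
have FA : F [set y : R | e / 2 < `|y - r|].
  have : UF [set z : T | e / 2 < `|z.1.2 x - r|] by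
    apply: filterS UnA => z; rewrite /A /= => /negP; rewrite -ltNge.
  by [].
have e20 : 0 < e / 2 by rewrite divr_gt0.
have [y [yA]] := rF _ _ FA (nbhsx_ballx r (e / 2) e20).
rewrite /ball /= distrC => h; exfalso.
by move: yA; rewrite /= ltNge (ltW h).
Qed.

(* Equicontinuity of the slopes reduces uniform closeness to a finite grid. *)
Lemma ultra_slope_uniform e : 0 < e ->
  exists2 A, UF A & forall z w, A z -> A w ->
    forall x, -1 <= x <= 1 -> `|z.1.2 x - w.1.2 x| <= e.
Proof.
move=> e0; have e3 : 0 < e / 3 by rewrite divr_gt0.
(* The mesh is [2 / N], and by Cauchy-Schwarz a slope oscillates on a cell by at most the square
   root of mesh times [K]; this choice makes it at most [e / 3]. *)
pose N := (Num.truncn (2 * K / (e / 3) ^+ 2)).+1.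
have NK : 2 * K / (e / 3) ^+ 2 < N%:R by exact: truncnS_gt.
have N0 : 0 < N%:R :> R by rewrite ltr0n.
pose grid (i : nat) : R := -1 + 2 * i%:R / N%:R.
have gridI i : (i <= N)%N -> -1 <= grid i <= 1.
  move=> iN; have i0 : 0 <= i%:R :> R by rewrite ler0n.
  have : i%:R / N%:R <= 1 :> R by rewrite ler_pdivrMr // mul1r ler_nat.
  have : 0 <= i%:R / N%:R :> R by rewrite divr_ge0 // ltW.
  by rewrite /grid -mulrA => h1 h2; apply/andP; split; lra.
have [A UA Ap] : exists2 A, UF A & forall z w, A z -> A w -> forall i, (i < N)%N ->
    `|z.1.2 (grid i) - w.1.2 (grid i)| <= e / 3.
  elim: {-2}N (leqnn N) => [|n IH] nN.
    by exists setT => //; exact: filterT.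
  have [A UA Ap] := IH (ltnW nN).
  have [A' UA' Ap'] := ultra_slope_pointwise (gridI _ (ltnW nN)) e3.
  exists (A `&` A'); first exact: filterI.
  move=> z w [Az A'z] [Aw A'w] i; rewrite ltnS leq_eqVlt => /predU1P[->|]; first exact: Ap'.
  exact: Ap.
exists (A `&` tame alpha m B M K); first exact: filterI.
move=> z w [Az Tz] [Aw Tw] x xI; have /andP[x1 x2] := xI.
have [i iN /andP[ix xi]] : exists2 i, (i < N)%N & grid i <= x <= grid i + 2 / N%:R.
  pose j := Num.truncn ((x + 1) * N%:R / 2).
  have t0 : 0 <= (x + 1) * N%:R / 2 by rewrite divr_ge0 // mulr_ge0 ?(ltW N0) //; lra.
  have [jN|Nj] := ltnP j N.
    exists j => //; have /andP[h1 h2] := truncn_itv t0; rewrite -/j in h1 h2.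
    have -> : x = -1 + 2 * ((x + 1) * N%:R / 2) / N%:R by field; lra.
    rewrite /grid lerD2l ler_pM2r ?invr_gt0 // ler_pM2l // h1 /=.
    rewrite -addrA lerD2l -mulrDl ler_pM2r ?invr_gt0 //.
    by move: h2; rewrite -natr1; lra.
  (* The cells found by truncation are half-open, so the endpoint [x = 1] falls outside and is
     assigned to the last one. *)
  exists N.-1; first by rewrite prednK.
  have h1 : N%:R <= (x + 1) * N%:R / 2.
    have /andP[h _] := truncn_itv t0; rewrite (le_trans _ h) // ler_nat //.
  have x1' : x = 1.
    apply/eqP; rewrite eq_le x2 /= -(ler_pM2r N0); move: h1; lra.
  have gN : grid N.-1 = 1 - 2 / N%:R.
    rewrite /grid; have -> : N.-1%:R = N%:R - 1 :> R by apply/eqP; rewrite eq_sym subr_eq natr1.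
    by field; lra.
  by rewrite gN x1'; apply/andP; split; rewrite ?subrK // gerBl divr_ge0 // ltW.
have gI := gridI _ (ltnW iN); have /andP[g1 g2] := gI.
have near v : tame alpha m B M K v -> `|v.1.2 x - v.1.2 (grid i)| <= e / 3.
  move=> [vN _ vK].
  rewrite -ler_sqr ?nnegrE ?(ltW e3) // real_normK ?num_real //.
  have ai := L1S g1 x2 (inN_L1 vN); have a2i := L1S g1 x2 (inN_L1_sqr vN).
  have := primitive_osc_sqr ix ai a2i (primitive_onS g1 x2 (inN_prim_g vN)).
  move=> /(_ (grid i) x); rewrite lexx ix lexx => /(_ isT isT) h.
  apply: (le_trans h).
  have h2 : Int (grid i) x (fun t => v.2 t ^+ 2) <= K.
    apply: le_trans vK; apply: Int_subset => //; last by move=> *; exact: sqr_ge0.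
    exact: inN_L1_sqr vN.
  apply: (@le_trans _ _ (2 / N%:R * K)).
    rewrite ler_pM ?subr_ge0 //; last by rewrite lerBlDl.
    by apply: Int_ge0 => *; exact: sqr_ge0.
  have e32 : 0 < (e / 3) ^+ 2 by rewrite exprn_gt0.
  by rewrite mulrAC ler_pdivrMr // [leRHS]mulrC -ler_pdivrMr // ltW.
have -> : z.1.2 x - w.1.2 x = (z.1.2 x - z.1.2 (grid i)) +
  ((z.1.2 (grid i) - w.1.2 (grid i)) - (w.1.2 x - w.1.2 (grid i))) by ring.
have e_eq : e = e / 3 + (e / 3 + e / 3) by field.
rewrite (le_trans (ler_normD _ _)) // [leRHS]e_eq lerD ?near // (le_trans (ler_normB _ _)) // lerD ?near //.
exact: Ap.
Qed.

Lemma ultra_L1_cauchy e : 0 < e ->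
  exists2 A, UF A & forall z w, A z -> A w -> Int (-1) 1 (fun x => `|z.2 x - w.2 x|) <= e.
Proof.
move=> e0.
have [L L0 lip] := @edens_lip R eps m B M eps0 m0.
set k := pi / 2 * (m / ds M ^+ 5) / 4 : R.
have k0 : 0 < k by rewrite !mulr_gt0 ?invr_gt0 ?exprn_gt0 ?ds_gt0 ?pi_gt0.
(* Half of [h] pays for the excess of the two energies over [I], half for the convexity defect. As
   the midpoint has energy at least [I], [k] times the squared L^2 distance is at most [h], and
   Cauchy-Schwarz on an interval of length 2 returns to L^1. *)
pose h := k * e ^+ 2 / 8.
have h0 : 0 < h by rewrite divr_gt0 // mulr_gt0 // exprn_gt0.
(* Slopes within [d] and equal values at -1 put the functions within [2 * d], so the total distance
   is [3 * d] and the defect [L * (3 * d) * (2 + K)] is at most [h / 2]. The added 1 keeps the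
   divisor positive. *)
pose d := h / (6 * (L * (2 + K) + 1)).
have LK : 0 <= L * (2 + K) by rewrite mulr_ge0 // addr_ge0.
have d0 : 0 < d by rewrite divr_gt0 // mulr_gt0 //; lra.
have [A UA Ad] := ultra_slope_uniform d0.
exists (A `&` [set z | tame alpha m B M K z /\ energy eps z < I + h / 2]).
  by apply: filterI => //; apply: UF_min; rewrite divr_gt0.
move=> z w [Az [[zN zb zK] zI]] [Aw [[wN wb wK] wI]].
have N11 : -1 <= 1 :> R by lra.
have dist x : -1 <= x <= 1 -> `|z.1.1 x - w.1.1 x| + `|z.1.2 x - w.1.2 x| <= 3 * d.
  move=> xI; have /andP[x1 x2] := xI.
  have pd := Ad _ _ Az Aw.
  have : `|z.1.1 x - w.1.1 x| <= d * (x - -1).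
    have up : primitive_on (-1) 1 (fun x => z.1.1 x - w.1.1 x) (fun x => z.1.2 x - w.1.2 x).
      move=> s t s1 st t1; rewrite IntB.
      - by rewrite -(inN_prim_p zN) // -(inN_prim_p wN) //; ring.
      - exact: L1S s1 t1 (inN_L1_p zN).
      - exact: L1S s1 t1 (inN_L1_p wN).
    have := primitive_upper xI (L1B (inN_L1_p zN) (inN_L1_p wN)) up pd.
    by rewrite (inN_uN1 zN) (inN_uN1 wN) subrr subr0.
  by have := pd x xI; have : d * (x - -1) <= d * 2 by [rewrite ler_wpM2l ?(ltW d0) //; lra]; lra.
have g2 := L1_sqr_mid (inN_L1 zN) (inN_L1 wN) (inN_L1_sqr zN) (inN_L1_sqr wN).
have mN := inN_mid zN wN.
have := Int_edens_mid m0 L0 lip zN wN zb wb zK wK _ dist.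
move/(_ (mulr_ge0 (ler0n _ 3) (ltW d0))); rewrite -/k.
have := I_le (z := (_, _, _)) mN; rewrite /energy /=.
move: zI wI; rewrite /energy => zI wI mI est.
have Ld : L * (3 * d) * (2 + K) <= h / 2.
  have -> : L * (3 * d) * (2 + K) = 3 * d * (L * (2 + K)) by ring.
  have : d * (6 * (L * (2 + K) + 1)) = h by rewrite /d divfK //; lra.
  by move: LK d0; move: (L * (2 + K)) => q; nra.
set S := Int (-1) 1 (fun x => (z.2 x - w.2 x) ^+ 2) in est.
have kS : k * S <= h by lra.
have Se : S <= e ^+ 2 / 8.
  by rewrite -(ler_pM2l k0) (le_trans kS) // /h -mulrA.
have cs := cauchy_schwarz_Int N11 (L1B (inN_L1 zN) (inN_L1 wN)) g2.2.
have i0 : 0 <= Int (-1) 1 (fun x => `|z.2 x - w.2 x|) by exact: Int_ge0.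
rewrite -ler_sqr ?nnegrE ?(ltW e0) //; apply: (le_trans cs).
have e2 := sqr_ge0 e; rewrite -/S; lra.
Qed.

Lemma ultra_fast_sequence : exists z_ : nat -> T, forall n,
  [/\ tame alpha m B M K (z_ n), energy eps (z_ n) < I + 2 ^- n &
    Int (-1) 1 (fun x => `|(z_ n.+1).2 x - (z_ n).2 x|) <= 2 ^- n.+1].
Proof.
have p2 n : 0 < 2 ^- n :> R by rewrite invr_gt0 exprn_gt0.
have /choice[A_ A_P] : forall n, exists A, UF A /\ forall z w, A z -> A w ->
    Int (-1) 1 (fun x => `|z.2 x - w.2 x|) <= 2 ^- n.+1.
  by move=> n; have [A ? ?] := ultra_L1_cauchy (p2 n.+1); exists A.
(* Nesting the sets puts the consecutive terms [z_ n] and [z_ n.+1] into the common set [A_ n]. *)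
pose A' := fix A' n := if n is n'.+1 then A' n' `&` A_ n else A_ 0%N.
have UA' n : UF (A' n).
  by elim: n => [|n IH] /=; [exact: (A_P 0%N).1|apply: filterI => //; exact: (A_P n.+1).1].
have A'A n z : A' n z -> A_ n z by case: n => [|n] //= [].
have A'S n z : A' n.+1 z -> A' n z by move=> [].
have /choice[z_ z_P] : forall n, exists z, A' n z /\ tame alpha m B M K z /\ energy eps z < I + 2 ^- n.
  by move=> n; have /filter_ex[z []] := @filterI _ UF UF_filter _ _ (UA' n) (UF_min (p2 n)); exists z.
exists z_ => n; have [Az [zT zE]] := z_P n; split => //.
by apply: (A_P n).2; apply: A'A => //; apply: A'S; exact: (z_P n.+1).1.
Qed.

End Selection.

Lemma direct_method alpha eps m B M K I : 0 <= eps -> 0 < m -> 0 <= K ->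
  (forall z, inN alpha z.1.1 z.1.2 z.2 -> I <= energy eps z) ->
  (forall e, 0 < e -> exists z, tame alpha m B M K z /\ energy eps z < I + e) ->
  exists u p g, inN alpha u p g /\ Int (-1) 1 (fun x => edens eps (u x) (p x) (g x)) <= I.
Proof.
move=> eps0 m0 K0 I_le I_min.
pose S e := [set z | tame alpha m B M K z /\ energy eps z < I + e].
pose F : set_system T := [set A | exists2 e, 0 < e & S e `<=` A].
have FF : ProperFilter F.
  apply: Build_ProperFilter.
    by case=> e e0 SA; have [z Sz] := I_min e e0; exact: (SA z).
  split.
  - by exists 1.
  - move=> A A' [e e0 SA] [e' e'0 SA']; exists (Num.min e e'); first by rewrite lt_min e0.
    move=> z [zT]; rewrite -ltrBlDl lt_min => /andP[h h']; split.
      by apply: SA; split => //; rewrite -ltrBlDl.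
    by apply: SA'; split => //; rewrite -ltrBlDl.
  - by move=> A A' AA' [e e0 SA]; exists e => //; exact: subset_trans AA'.
have [U [UU FU]] := ultraFilterLemma FF.
have Umin e : 0 < e -> U (S e) by move=> e0; apply: FU; exists e.
have [z_ z_P] := ultra_fast_sequence eps0 m0 K0 I_le UU Umin.
apply: (@inN_limit _ alpha eps m K I (fun n => (z_ n).1.1) (fun n => (z_ n).1.2) (fun n => (z_ n).2)) => //.
- by move=> n; have [[]] := z_P n.
- by move=> n x xI; have [[_ bz _] _ _] := z_P n; have [/andP[]] := bz x xI.
- by move=> n; have [[]] := z_P n.
- by move=> n; have [] := z_P n.
- move=> e e0; have : geometric 1 (2^-1 : R) n @[n --> \oo] --> 0.
    by apply: cvg_geometric; rewrite ger0_norm //; lra.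
  move/cvgrPdist_le => /(_ _ e0); apply: filterS => n; rewrite sub0r normrN.
  rewrite /geometric /= mul1r ger0_norm ?exprn_ge0 // exprVn => ne.
  by have [_ h _] := z_P n; rewrite (le_trans (ltW h)) // lerD2l.
Qed.

End DirectMethod.

(** * Existence from a competitor, and the cylinder *)

Section Minimizers.
Variable R : realType.
Local Notation T := ((R -> R) * (R -> R) * (R -> R))%type.
Implicit Types (alpha eps c x l : R) (u p g v q h : R -> R) (z w : T).

Lemma energyE alpha eps u p g : inN alpha u p g ->
  energy eps (u, p, g) = pi / 2 * Int (-1) 1 (wint u p g) +
    eps * (2 * pi * Int (-1) 1 (fun x => k2 (u x) (p x))).
Proof. by move=> uN; rewrite /energy /= (Int_edens uN). Qed.

Lemma inN_wint_ge0 alpha u p g : inN alpha u p g -> 0 <= Int (-1) 1 (wint u p g).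
Proof. by move=> uN; apply: Int_ge0 => x xI; apply: wint_ge0; exact: inN_gt0 uN _ xI. Qed.

Lemma inN_k2_gt0 alpha u p g x : inN alpha u p g -> -1 <= x <= 1 -> 0 < k2 (u x) (p x).
Proof. by move=> uN xI; rewrite mulr_gt0 ?ds_gt0 // (inN_gt0 uN). Qed.

Lemma inN_k2_ge0 alpha u p g : inN alpha u p g -> 0 <= Int (-1) 1 (fun x => k2 (u x) (p x)).
Proof. by move=> uN; apply: Int_ge0 => x xI; rewrite ltW // (inN_k2_gt0 uN). Qed.

(** The given triple only sets the threshold. Either it attains the infimum, or triples close enough
    to the infimum lie below it, where [low] and hence the a priori bounds apply. *)
Lemma minimizer_exists alpha eps c u p g : 0 < alpha -> 0 <= eps -> 0 <= c -> c < 1 ->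
  inN alpha u p g ->
  (forall v q h, inN alpha v q h -> energy eps (v, q, h) <= energy eps (u, p, g) ->
    Int (-1) 1 (wint v q h) <= 8 * c) ->
  exists u p g, inN alpha u p g /\ forall v q h, inN alpha v q h ->
    (helfrichF eps u p g <= helfrichF eps v q h)%E.
Proof.
move=> alpha0 eps0 c0 c1 uN low.
pose E := [set energy eps z | z in [set z : T | inN alpha z.1.1 z.1.2 z.2]].
have lbE : lbound E 0.
  move=> _ [z zN <-]; apply: Int_ge0 => x xI; apply: edens_ge0 => //.
  exact: inN_gt0 zN _ xI.
have hE : has_inf E by split; [exists (energy eps (u, p, g)); exists (u, p, g)|exists 0].
have I_le z : inN alpha z.1.1 z.1.2 z.2 -> inf E <= energy eps z.
  by move=> zN; apply: ge_inf; [exists 0|exists z].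
have [Iw|wI] := ltP (inf E) (energy eps (u, p, g)); last first.
  exists u, p, g; split => // v q h vN; rewrite (helfrichE uN) (helfrichE vN) lee_fin.
  exact: le_trans wI (I_le (v, q, h) vN).
have [m [B [M [K [m0 M0 K0 bounds]]]]] := inN_bounds alpha0 c0 c1.
have [e e0|v [q [h [vN vE]]]] := @direct_method R alpha eps m B M K (inf E) eps0 m0 K0 I_le.
  have d0 : 0 < Num.min e (energy eps (u, p, g) - inf E) by rewrite lt_min e0 subr_gt0.
  have [_ [[[v q] h] /= vN <-] vE] := inf_adherent d0 hE.
  move: vE; rewrite -ltrBlDl lt_min => /andP[h1 h2].
  have vE : energy eps (v, q, h) <= energy eps (u, p, g) by lra.
  have [b1 b2] := bounds v q h vN (low v q h vN vE).
  by exists (v, q, h); split; [split|rewrite -ltrBlDl].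
exists v, q, h; split => // v' q' h' v'N; rewrite (helfrichE vN) (helfrichE v'N) lee_fin.
exact: le_trans vE (I_le (v', q', h') v'N).
Qed.

(** The area term is nonnegative, so the Willmore energy is at most the total energy, and [c] is the
    energy of the competitor divided by 4 pi. *)
Lemma minimizer_exists_lt alpha eps u p g : 0 < alpha -> 0 <= eps ->
  inN alpha u p g -> energy eps (u, p, g) < 4 * pi ->
  exists u p g, inN alpha u p g /\ forall v q h, inN alpha v q h ->
    (helfrichF eps u p g <= helfrichF eps v q h)%E.
Proof.
move=> alpha0 eps0 uN uE; have pi0 := @pi_gt0 R.
have pos v q h : inN alpha v q h -> pi / 2 * Int (-1) 1 (wint v q h) <= energy eps (v, q, h).
  move=> vN; rewrite (energyE _ vN) lerDl.
  have := inN_k2_ge0 vN; set A := Int _ _ _ => A0.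
  by rewrite !mulr_ge0 // ltW.
have E0 : 0 <= energy eps (u, p, g).
  by apply: le_trans (pos _ _ _ uN); rewrite mulr_ge0 ?(inN_wint_ge0 uN) // divr_ge0 // ltW.
apply: (@minimizer_exists alpha eps (energy eps (u, p, g) / (4 * pi)) u p g) => //.
- by rewrite divr_ge0 // mulr_ge0 // ltW.
- by rewrite ltr_pdivrMr ?mulr_gt0 // mul1r.
- move=> v q h vN vE; have := le_trans (pos _ _ _ vN) vE.
  rewrite mulrA ler_pdivlMr ?mulr_gt0 //; lra.
Qed.

(* From 1 / s >= 2 l - l^2 s, optimised over l. *)
Lemma k1_k2_ge4 alpha u p g : inN alpha u p g ->
  4 <= Int (-1) 1 (wint u p g) * Int (-1) 1 (fun x => k2 (u x) (p x)).
Proof.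
move=> uN; have k1i := inN_L1_k1 uN; have k2i := inN_L1_k2 uN.
have N11 : -1 <= 1 :> R by lra.
set Q := Int _ _ (wint u p g); set A := Int _ _ _.
have Q0 : 0 <= Q := inN_wint_ge0 uN.
have A0 : 0 <= A := inN_k2_ge0 uN.
have key l : 4 * l - l ^+ 2 * A <= Q.
  apply: (@le_trans _ _ (Int (-1) 1 (fun x => k1 (u x) (p x)))); last first.
    rewrite /Q (Int_wint uN) lerDl; apply: Int_ge0 => x xI.
    rewrite mulr_ge0 ?sqr_ge0 // divr_ge0 ?exprn_ge0 // ltW ?ds_gt0 //.
    exact: inN_gt0 uN _ xI.
  have -> : 4 * l - l ^+ 2 * A = Int (-1) 1 (fun x => cst (2 * l) x - l ^+ 2 * k2 (u x) (p x)).
    rewrite (IntB (L1_cst _ _ _) (L1Z _ k2i)) (IntZ _ k2i) (Int_cst _ N11) -/A; ring.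
  apply: le_Int => //; first by apply: L1B; [exact: L1_cst|exact: L1Z].
  move=> x xI; have k20 := inN_k2_gt0 uN xI.
  have -> : k1 (u x) (p x) = (k2 (u x) (p x))^-1 by [].
  move: (k2 _ _) k20 => s s0 /=.
  rewrite -subr_ge0 (_ : _ - _ = (1 - l * s) ^+ 2 / s); last by field; lra.
  by rewrite divr_ge0 ?sqr_ge0 // ltW.
(* If [A] were 0, the left side of [key] would be unbounded in [l]. *)
have A1 : 0 < A.
  rewrite lt_neqAle A0 andbT eq_sym; apply/negP => /eqP AE.
  by have := key (Q + 1); rewrite AE mulr0; lra.
have := key (2 / A); rewrite (_ : _ - _ = 4 / A); last by field; lra.
by rewrite ler_pdivrMr.
Qed.

Lemma inN_cst alpha : 0 < alpha -> inN alpha (cst alpha) (cst 0) (cst 0).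
Proof.
move=> alpha0; have c0 k : L1 (-1) 1 (cst k : R -> R) by exact: L1_cst.
split => //; split => //.
- exact: c0.
- by apply: (@eq_L1 _ _ _ (cst 0)) => [x _|]; [rewrite /= expr0n|exact: c0].
- by move=> x /= xI; rewrite (_ : Rintegral _ _ _ = Int (-1) x (cst 0)) // Int_cst ?mul0r ?addr0 //;
    move: xI; rewrite /I11 /= in_itv /= => /andP[].
- by move=> x /= xI; rewrite (_ : Rintegral _ _ _ = Int (-1) x (cst 0)) // Int_cst ?mul0r ?addr0 //;
    move: xI; rewrite /I11 /= in_itv /= => /andP[].
Qed.

Lemma energy_cst alpha eps : 0 < alpha ->
  energy eps (cst alpha, cst 0, cst 0) = pi / alpha + 4 * pi * eps * alpha.
Proof.
move=> alpha0; have N11 : -1 <= 1 :> R by lra.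
have ds0 : ds (0 : R) = 1 by rewrite /ds expr0n addr0 sqrtr1.
rewrite /energy /= /edens /k1 /k2 /k3 ds0.
by rewrite (Int_cst _ N11); field; lra.
Qed.

(** Divided by 4 pi, the two roots of the quadratic in W are [1 / (4 * alpha)] and [eps * alpha];
    the assumptions of case (i) say that both are below 1, and their maximum serves as [c]. *)
Lemma minimizer_cylinder alpha eps : 1 / 4 < alpha -> 0 <= eps -> eps < 1 / alpha ->
  exists u p g, inN alpha u p g /\ forall v q h, inN alpha v q h ->
    (helfrichF eps u p g <= helfrichF eps v q h)%E.
Proof.
move=> alpha4 eps0 epsa; have alpha0 : 0 < alpha by lra.
have pi0 := @pi_gt0 R.
have ea : eps * alpha < 1 by rewrite -ltr_pdivlMr.
have ea0 : 0 <= eps * alpha by rewrite mulr_ge0 // ltW.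
have a4 : (4 * alpha)^-1 < 1 by rewrite invf_lt1 ?mulr_gt0 //; lra.
have a40 : 0 <= (4 * alpha)^-1 by rewrite invr_ge0 mulr_ge0 // ltW.
apply: (@minimizer_exists alpha eps (Num.max (4 * alpha)^-1 (eps * alpha)) (cst alpha) (cst 0) (cst 0)) => //.
- by rewrite le_max a40.
- by rewrite gt_max a4.
- exact: inN_cst.
move=> v q h vN; rewrite (energyE _ vN) (energy_cst _ alpha0).
have QA := k1_k2_ge4 vN; have Q0 := inN_wint_ge0 vN.
move: (Int _ _ (fun x => _)) (Int _ _ (wint _ _ _)) QA Q0 => A Q QA Q0 HE.
have {HE} HE : Q / 2 + 2 * eps * A <= alpha^-1 + 4 * eps * alpha.
  by rewrite -(ler_pM2l pi0); lra.
have eA : 4 * eps <= eps * (Q * A) by rewrite mulrC ler_wpM2l.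
(* The energy inequality multiplied by [2 * Q], with [Q * A] replaced by its lower bound 4. *)
have : (Q - 8 * (4 * alpha)^-1) * (Q - 8 * (eps * alpha)) <= 0.
  have -> : (Q - 8 * (4 * alpha)^-1) * (Q - 8 * (eps * alpha)) =
    2 * Q * (Q / 2 + 2 * eps * A - (alpha^-1 + 4 * eps * alpha)) - 4 * (eps * (Q * A) - 4 * eps).
    by field; lra.
  have h1 : 2 * Q * (Q / 2 + 2 * eps * A - (alpha^-1 + 4 * eps * alpha)) <= 0.
    by rewrite mulr_ge0_le0 ?mulr_ge0 // subr_le0.
  by lra.
move=> prod; rewrite leNgt; apply/negP; rewrite maxr_pMr // gt_max => /andP[h1 h2].
have : 0 < (Q - 8 * (4 * alpha)^-1) * (Q - 8 * (eps * alpha)) by rewrite mulr_gt0 // subr_gt0.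
by rewrite ltNge prod.
Qed.

End Minimizers.

(** * Functions defined piecewise and their primitives *)

Section Glue.
Variable R : realType.
Local Notation mu := (@lebesgue_measure R).
Implicit Types (a b c x y : R) (f g F : R -> R).

Definition glue b f1 f2 x : R := if x <= b then f1 x else f2 x.

Lemma glue_le b f1 f2 x : x <= b -> glue b f1 f2 x = f1 x.
Proof. by rewrite /glue => ->. Qed.

Lemma glue_gt b f1 f2 x : b < x -> glue b f1 f2 x = f2 x.
Proof. by rewrite /glue => bx; rewrite leNgt bx. Qed.

Lemma subset_oc_cc a b : `]a, b]%classic `<=` `[a, b]%classic.
Proof. by move=> x /=; rewrite !in_itv /= => /andP[/ltW -> ->]. Qed.

Lemma measurable_oc a b : @measurable _ (measurableTypeR R) `]a, b]%classic.
Proof. exact: measurable_itv. Qed.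

Lemma L1_glue a b c f1 f2 : a <= b -> b <= c -> L1 a b f1 -> L1 b c f2 ->
  L1 a c (glue b f1 f2).
Proof.
move=> ab bc i1 i2.
have m1 : mu.-integrable `[a, b] (EFin \o glue b f1 f2).
  by apply: (eq_L1 _ i1) => x /andP[_ xb]; rewrite glue_le.
have m2 : mu.-integrable `]b, c] (EFin \o glue b f1 f2).
  apply: (eq_integrable (measurable_oc b c) (EFin \o f2)).
    by move=> x; rewrite inE /= in_itv /= => /andP[bx _]; rewrite glue_gt.
  exact: integrableS (measurable_cc b c) (measurable_oc b c) (@subset_oc_cc _ _) i2.
have U : `[a, c]%classic = `[a, b] `|` `]b, c] :> set (measurableTypeR R).
  by rewrite -itv_bndbnd_setU // bnd_simp.
have mU : measurable_fun (`[a, b] `|` `]b, c]) (EFin \o glue b f1 f2).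
  apply: (measurable_funU _ (measurable_cc a b) (measurable_oc b c)).2.
  by split; [case/integrableP: m1|case/integrableP: m2].
rewrite /L1 U; apply/integrableP; split => //.
rewrite (ge0_integral_setU _ (measurable_cc a b) (measurable_oc b c)) //.
- by apply: lte_add_pinfty; [case/integrableP: m1|case/integrableP: m2].
- exact: measurableT_comp.
- apply/disj_setPS => x [/=]; rewrite !in_itv /= => /andP[_ xb] /andP[bx _].
  by move: bx; rewrite ltNge xb.
Qed.

(** The integrands may differ at [x] when [x = b]; passing to half-open intervals discards that
    point. *)
Lemma Int_glue_gt b c x f1 f2 : b <= x -> L1 x c f2 -> L1 x c (glue b f1 f2) ->
  Int x c (glue b f1 f2) = Int x c f2.
Proof.
move=> bx i1 i2; rewrite /Int -2?Rintegral_itv_obnd_cbnd.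
- apply: eq_Rintegral => z; rewrite inE /= in_itv /= => /andP[xz _].
  by rewrite glue_gt // (le_lt_trans bx).
- exact: integrableS (measurable_cc x c) (measurable_oc x c) (@subset_oc_cc _ _) i1.
- exact: integrableS (measurable_cc x c) (measurable_oc x c) (@subset_oc_cc _ _) i2.
Qed.

(** The derivative may jump at [b], as u'' does where the catenoid meets the sphere. *)
Lemma glue_primitive a b c F1 f1 F2 f2 : a <= b -> b <= c -> L1 a b f1 -> L1 b c f2 ->
  primitive_on a b F1 f1 -> primitive_on b c F2 f2 -> F1 b = F2 b ->
  primitive_on a c (glue b F1 F2) (glue b f1 f2).
Proof.
move=> ab bc i1 i2 p1 p2 Fb x y ax xy yc.
have gi := L1_glue ab bc i1 i2.
have left s t : a <= s -> s <= t -> t <= b -> Int s t (glue b f1 f2) = F1 t - F1 s.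
  move=> as_ st tb; rewrite p1 //; apply: eq_Int => z /andP[_ zt].
  by rewrite glue_le // (le_trans zt).
have right s t : b <= s -> s <= t -> t <= c -> Int s t (glue b f1 f2) = F2 t - F2 s.
  move=> bs st tc; rewrite p2 // Int_glue_gt //; first exact: L1S bs tc i2.
  exact: L1S (le_trans ab bs) tc gi.
have [yb|by_] := leP y b.
  by rewrite !glue_le // ?(le_trans xy) // left.
have [xb|bx] := leP x b.
  rewrite (@glue_le _ _ _ x) // (@glue_gt _ _ _ y) // (@Int_chasles _ _ b) ?(ltW by_) //.
    by rewrite (left x b) // (right b y) ?(ltW by_) // Fb; ring.
  exact: L1S ax yc gi.
by rewrite !glue_gt // right // ltW.
Qed.

Lemma primitive_ftc a b F f : (forall x, a <= x <= b -> is_derive x 1 F (f x)) ->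
  {within `[a, b], continuous f} -> primitive_on a b F f.
Proof.
move=> Ff cf x y ax; rewrite le_eqVlt => /predU1P[<-|xy] yb.
  by rewrite Int_xx subrr.
have xyab z : x <= z <= y -> a <= z <= b.
  by move=> /andP[xz zy]; rewrite (le_trans ax) // (le_trans zy).
have dF z : x <= z <= y -> derivable F z 1.
  by move=> zxy; exact: (@ex_derive _ _ _ _ _ _ _ (Ff z (xyab z zxy))).
have cF z : x <= z <= y -> {for z, continuous F}.
  by move=> /dF Fz; apply: differentiable_continuous; exact/derivable1_diffP.
have x_in : x <= x <= y by rewrite lexx ltW.
have y_in : x <= y <= y by rewrite lexx ltW.
rewrite /Int /Rintegral (@continuous_FTC2 _ f F) //.
- exact: continuous_itvS ax yb cf.
- split.
  + by move=> z; rewrite in_itv /= => /andP[xz zy]; apply: dF; rewrite !ltW.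
  + exact: cvg_at_right_filter (cF x x_in).
  + exact: cvg_at_left_filter (cF y y_in).
- move=> z; rewrite in_itv /= => /andP[xz zy]; rewrite derive1E.
  by apply: derive_val; apply: Ff; apply: xyab; rewrite !ltW.
Qed.

End Glue.

(** * Hyperbolic functions *)

Section Hyperbolic.
Variable R : realType.
Implicit Types (x y z : R).

Lemma cosh_sqr x : coshR x ^+ 2 = 1 + sinhR x ^+ 2.
Proof.
by rewrite /coshR /sinhR; have := expRxMexpNx_1 x; move: (expR x) (expR (- x)) => a b h; nra.
Qed.

Lemma coshR_gt0 x : 0 < coshR x.
Proof. by rewrite divr_gt0 // addr_gt0 // expR_gt0. Qed.

Lemma coshR_ge1 x : 1 <= coshR x.
Proof.
rewrite -ler_sqr ?nnegrE ?(ltW (coshR_gt0 x)) // expr1n cosh_sqr lerDl; exact: sqr_ge0.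
Qed.

Lemma is_derive_expRN x : is_derive x 1 (fun y : R => expR (- y)) (- expR (- x)).
Proof.
apply: (is_derive_eq (is_derive1_comp (is_derive_expR (- x)) (is_deriveN (is_derive_id x (1 : R))))).
by rewrite mulrN1.
Qed.

Lemma is_derive_coshR x : is_derive x 1 (@coshR R) (sinhR x).
Proof.
apply: (is_derive_eq (is_deriveM (is_deriveD (is_derive_expR x) (is_derive_expRN x))
  (is_derive_cst (2^-1 : R) x (1 : R)))).
by rewrite /GRing.scale /= mulr0 add0r mulrC.
Qed.

Lemma is_derive_sinhR x : is_derive x 1 (@sinhR R) (coshR x).
Proof.
apply: (is_derive_eq (is_deriveM (is_deriveB (is_derive_expR x) (is_derive_expRN x))
  (is_derive_cst (2^-1 : R) x (1 : R)))).
by rewrite /GRing.scale /= mulr0 add0r opprK mulrC.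
Qed.

Lemma continuous_derive f (df : R -> R) : (forall x, is_derive x 1 f (df x)) -> continuous f.
Proof.
move=> fdf x; apply: differentiable_continuous; apply/derivable1_diffP.
exact: (@ex_derive _ _ _ _ _ _ _ (fdf x)).
Qed.

Lemma sinhR0 : sinhR 0 = 0 :> R.
Proof. by rewrite /sinhR oppr0 subrr mul0r. Qed.

Lemma sinhR_ge x : 0 <= x -> x <= sinhR x.
Proof.
move=> x0; have [c _ e] := MVT_segment x0 (fun z _ => is_derive_sinhR z)
  (continuous_subspaceT (continuous_derive is_derive_sinhR)).
by move: e; rewrite sinhR0 !subr0 => ->; rewrite ler_peMl // coshR_ge1.
Qed.

Lemma sinhR3 x : sinhR (3 * x) = 3 * sinhR x + 4 * sinhR x ^+ 3.
Proof.
rewrite /sinhR -mulrN !expRM_natl; have := expRxMexpNx_1 x.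
move: (expR x) (expR (- x)) => a b ab.
have e : (a - b) ^+ 3 = a ^+ 3 - b ^+ 3 - 3 * (a * b) * (a - b) by ring.
rewrite ab in e.
have -> : 3 * ((a - b) / 2) + 4 * ((a - b) / 2) ^+ 3 = (3 * (a - b) + (a - b) ^+ 3) / 2 by field.
by rewrite e; field.
Qed.

(** The linear bound at [x / 3], fed into the formula for the triple argument; this yields 4/27 in
    place of the Taylor coefficient 1/6. *)
Lemma sinhR_ge_cubic x : 0 <= x -> x + 4 / 27 * x ^+ 3 <= sinhR x.
Proof.
move=> x0; rewrite -[x in leRHS](_ : 3 * (x / 3) = x); last by field.
have x30 : 0 <= x / 3 by rewrite divr_ge0.
have h := sinhR_ge x30; rewrite sinhR3.
have h3 : (x / 3) ^+ 3 <= sinhR (x / 3) ^+ 3 by rewrite lerXn2r ?nnegrE // (le_trans x30).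
have -> : x + 4 / 27 * x ^+ 3 = 3 * (x / 3) + 4 * (x / 3) ^+ 3 by field.
by lra.
Qed.

Lemma coshR_le x y : 0 <= x -> x <= y -> coshR x <= coshR y.
Proof.
move=> x0 xy; have [c] := MVT_segment xy (fun z _ => is_derive_coshR z)
  (continuous_subspaceT (continuous_derive is_derive_coshR)).
rewrite in_itv /= => /andP[xc _] e; rewrite -subr_ge0 e mulr_ge0 ?subr_ge0 //.
have c0 := le_trans x0 xc; exact: le_trans c0 (sinhR_ge c0).
Qed.

Lemma tanhR_le x y : x <= y -> tanhR x <= tanhR y.
Proof.
move=> xy; rewrite /tanhR ler_pdivrMr ?coshR_gt0 // mulrAC ler_pdivlMr ?coshR_gt0 //.
have : expR x <= expR y by rewrite ler_expR.
have : expR (- y) <= expR (- x) by rewrite ler_expR lerN2.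
rewrite /sinhR /coshR; have := expR_gt0 x; have := expR_gt0 y.
have := expR_gt0 (- x); have := expR_gt0 (- y).
move: (expR x) (expR (- x)) (expR y) (expR (- y)) => a a' b b' ? ? ? ? h1 h2.
have : a * b' <= b * a' by rewrite ler_pM // ltW.
by lra.
Qed.

Lemma tanhR_lt1 x : tanhR x < 1.
Proof.
rewrite ltr_pdivrMr ?coshR_gt0 // mul1r /sinhR /coshR.
by have := expR_gt0 (- x); lra.
Qed.

(** Follows from [1 - 2 x <= exp (- 2 x)]. The factor 2 is the one of the cross term of the square
    in [catenoid_radius_le]. *)
Lemma sinhR_le_coshR x : 0 <= x -> sinhR x <= 2 * x * coshR x.
Proof.
move=> x0; have h := expR_ge1Dx (- (2 * x)).
have e2 : expR (- (2 * x)) * expR x = expR (- x) by rewrite -expRD; congr expR; ring.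
have : (1 - 2 * x) * expR x <= expR (- x) by rewrite -e2 ler_wpM2r ?expR_ge0.
rewrite /sinhR /coshR; have := expR_gt0 (- x).
move: (expR x) (expR (- x)) => a b b0 h'.
by have : 0 <= x * b by [rewrite mulr_ge0 // ltW]; lra.
Qed.

End Hyperbolic.

(** * The competitor of case (ii): two catenoid pieces joined by a zone of a sphere *)

Section CatenoidSphere.
Variable R : realType.
Implicit Types (x z : R).

Lemma is_derive_comp_affine (f df : R -> R) (a b x : R) :
  (forall z, is_derive z 1 f (df z)) -> is_derive x 1 (fun z => f (a + b * z)) (b * df (a + b * x)).
Proof.
move=> fdf.
have h : is_derive x 1 (fun z : R => a + b * z) b.
  apply: (is_derive_eq (is_deriveD (is_derive_cst a x (1 : R))
    (is_deriveM (is_derive_cst b x (1 : R)) (is_derive_id x (1 : R))))).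
  by rewrite /GRing.scale /= mulr0 mulr1 addr0 add0r.
have := @is_derive1_comp _ f (fun z => a + b * z) x _ _ (fdf (a + b * x)) h.
by rewrite mulrC.
Qed.

Lemma is_deriveMl (f : R -> R) (k df x : R) : is_derive x 1 f df ->
  is_derive x 1 (fun z => k * f z) (k * df).
Proof.
move=> h; apply: (is_derive_eq (is_deriveM (is_derive_cst k x (1 : R)) h)).
by rewrite /GRing.scale /= mulr0 addr0.
Qed.

Variables (alpha y : R).
Hypotheses (alpha0 : 0 < alpha) (y0 : 0 <= y).
Hypothesis yE : alpha * (y + sinhR y * coshR y) = 1.

(** The catenoid leaves -1 with height [alpha] and, after the length [alpha * y], has height
    [alpha * cosh y] and slope [sinh y]. A circle centred at the origin satisfies u u' = -x, so a
    tangential junction lies at [- t], and Pythagoras gives the radius [r]. The hypothesis [yE] says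
    that the lengths [alpha * y] and [t] fill [-1, 0]. *)
Let k := alpha^-1.
Let t := alpha * (sinhR y * coshR y).
Let r := alpha * coshR y ^+ 2.

Let k0 : 0 < k. Proof. by rewrite /k invr_gt0. Qed.
Let s0 : 0 < sinhR y.
Proof.
have : 0 < y; last by move=> h; exact: lt_le_trans h (sinhR_ge y0).
rewrite lt_neqAle y0 andbT; apply/negP => /eqP h.
by move: yE; rewrite -h sinhR0 mul0r addr0 mulr0; lra.
Qed.
Let c0 := coshR_gt0 y.
Let t0 : 0 < t. Proof. exact: mulr_gt0 alpha0 (mulr_gt0 s0 c0). Qed.
Let tE : alpha * y = 1 - t. Proof. by move: yE; rewrite mulrDr /t; lra. Qed.
Let t1 : t <= 1. Proof. by have : 0 <= alpha * y by [rewrite mulr_ge0 // ltW]; rewrite tE; lra. Qed.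
Let r0 : 0 < r. Proof. by rewrite /r mulr_gt0 // exprn_gt0. Qed.
Let ky : k * (1 - t) = y. Proof. by rewrite -tE /k mulKf // gt_eqF. Qed.

Let rt : r ^+ 2 - t ^+ 2 = (alpha * coshR y) ^+ 2.
Proof.
rewrite /r /t; have -> : (alpha * coshR y ^+ 2) ^+ 2 - (alpha * (sinhR y * coshR y)) ^+ 2 =
  (alpha * coshR y) ^+ 2 * (coshR y ^+ 2 - sinhR y ^+ 2) by ring.
by rewrite cosh_sqr addrK mulr1.
Qed.

Let sph x : R := Num.sqrt (r ^+ 2 - x ^+ 2).

Let sph_sqr x : - t <= x <= t -> 0 < r ^+ 2 - x ^+ 2.
Proof.
move=> xt; apply: (@lt_le_trans _ _ (r ^+ 2 - t ^+ 2)).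
  by rewrite rt exprn_gt0 // mulr_gt0.
rewrite lerD2l lerN2 -(real_normK (num_real x)) ler_sqr ?nnegrE ?(ltW t0) //.
by rewrite ler_norml.
Qed.

Let sph_gt0 x : - t <= x <= t -> 0 < sph x. Proof. by move=> /sph_sqr h; rewrite sqrtr_gt0. Qed.
Let sphE x : - t <= x <= t -> sph x ^+ 2 = r ^+ 2 - x ^+ 2.
Proof. by move=> /sph_sqr h; rewrite sqr_sqrtr // ltW. Qed.

Let sph_t x : x ^+ 2 = t ^+ 2 -> sph x = alpha * coshR y.
Proof. by move=> h; rewrite /sph h rt sqrtr_sqr ger0_norm // mulr_ge0 ?ltW. Qed.

Let is_derive_sph x : - t <= x <= t -> is_derive x 1 sph (- x / sph x).
Proof.
move=> xt; have s0' := sph_gt0 xt.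
have d1 : is_derive x 1 (cst (r ^+ 2) - (@id R) ^+ 2) (0 - (2%:R * x ^+ 1) *: 1).
  by apply: is_deriveB.
have q0 : 0 < (cst (r ^+ 2) - (@id R) ^+ 2) x by exact: sph_sqr.
apply: (is_derive_eq (is_derive1_comp (is_derive1_sqrt q0) d1)).
rewrite /= -/(sph x) /GRing.scale /= mulr1 expr1.
change (Num.sqrt _) with (sph x).
by field; lra.
Qed.

Let is_derive_dsph x : - t <= x <= t ->
  is_derive x 1 (fun z => - z / sph z) (- r ^+ 2 / sph x ^+ 3).
Proof.
move=> xt; have s0' := sph_gt0 xt.
have sn : sph x != 0 by rewrite gt_eqF.
apply: (is_derive_eq (is_deriveM (is_deriveN (is_derive_id x (1 : R)))
  (is_deriveV sn (is_derive_sph xt)))).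
rewrite /GRing.scale /= mulrN1 (_ : (- @id R) x = - x) //.
have -> : r ^+ 2 = sph x ^+ 2 + x ^+ 2 by rewrite sphE // subrK.
by field.
Qed.

Let vl x := alpha * coshR (k + k * x).
Let pl x := sinhR (k + k * x).
Let gl x := k * coshR (k + k * x).
Let vr x := alpha * coshR (k + - k * x).
Let pr x := - sinhR (k + - k * x).
Let gr x := k * coshR (k + - k * x).

Let v := glue t (glue (- t) vl sph) vr.
Let p := glue t (glue (- t) pl (fun x => - x / sph x)) pr.
Let g := glue t (glue (- t) gl (fun x => - r ^+ 2 / sph x ^+ 3)) gr.

Let ak : alpha * k = 1. Proof. by rewrite /k divff // gt_eqF. Qed.

Let is_derive_vl x : is_derive x 1 vl (pl x).
Proof.
apply: (is_derive_eq (is_deriveMl alpha (is_derive_comp_affine k k x (@is_derive_coshR R)))).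
by rewrite mulrA ak mul1r.
Qed.
Let is_derive_vr x : is_derive x 1 vr (pr x).
Proof.
apply: (is_derive_eq (is_deriveMl alpha (is_derive_comp_affine k (- k) x (@is_derive_coshR R)))).
by rewrite mulrA mulrN ak mulN1r.
Qed.
Let is_derive_pl x : is_derive x 1 pl (gl x).
Proof. exact: (is_derive_comp_affine k k x (@is_derive_sinhR R)). Qed.
Let is_derive_pr x : is_derive x 1 pr (gr x).
Proof.
apply: (is_derive_eq (is_deriveN (is_derive_comp_affine k (- k) x (@is_derive_sinhR R)))).
by rewrite mulNr opprK.
Qed.
Let continuous_gl : continuous gl.
Proof.
apply: (@continuous_derive _ _ (fun x => k * (k * sinhR (k + k * x)))) => x.
exact: is_deriveMl (is_derive_comp_affine k k x (@is_derive_coshR R)).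
Qed.
Let continuous_gr : continuous gr.
Proof.
apply: (@continuous_derive _ _ (fun x => k * (- k * sinhR (k + - k * x)))) => x.
exact: is_deriveMl (is_derive_comp_affine k (- k) x (@is_derive_coshR R)).
Qed.

Let tt : - t <= t. Proof. by have := t0; lra. Qed.
Let N1t : -1 <= - t. Proof. by have := t1; lra. Qed.

Let within_derive a b (f df : R -> R) : (forall x, a <= x <= b -> is_derive x 1 f (df x)) ->
  {within `[a, b], continuous f}.
Proof.
move=> h; apply: derivable_within_continuous => x; rewrite in_itv /= => xab.
exact: (@ex_derive _ _ _ _ _ _ _ (h x xab)).
Qed.

Let cont_gs : {within `[- t, t], continuous (fun x => - r ^+ 2 / sph x ^+ 3)}.
Proof.
apply: within_continuousM; first by move=> x; exact: cvg_cst.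
apply: within_continuousV => [x /=|].
  by rewrite in_itv /= => xt; rewrite expf_neq0 // gt_eqF // sph_gt0.
by apply: within_continuousX; apply: within_derive => x; exact: is_derive_sph.
Qed.

Let cgl a b : {within `[a, b], continuous gl}. Proof. exact: continuous_subspaceT. Qed.
Let cgr a b : {within `[a, b], continuous gr}. Proof. exact: continuous_subspaceT. Qed.

Let at_left : k + k * - t = y. Proof. by rewrite mulrN -{1}[k]mulr1 -mulrBr. Qed.
Let at_right : k + - k * t = y. Proof. by rewrite mulNr -{1}[k]mulr1 -mulrBr. Qed.

Let slope_t : t / (alpha * coshR y) = sinhR y.
Proof. by rewrite /t; field; rewrite !gt_eqF. Qed.

Let v_left : vl (- t) = sph (- t).
Proof. by rewrite /vl at_left sph_t // sqrrN. Qed.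
Let v_right : sph t = vr t.
Proof. by rewrite /vr at_right sph_t. Qed.
Let p_left : pl (- t) = - - t / sph (- t).
Proof. by rewrite /pl at_left -v_left /vl at_left opprK slope_t. Qed.
Let p_right : - t / sph t = pr t.
Proof. by rewrite /pr at_right v_right /vr at_right mulNr slope_t. Qed.

Let glue3_L1 (f1 f2 f3 : R -> R) : {within `[-1, - t], continuous f1} ->
  {within `[- t, t], continuous f2} -> {within `[t, 1], continuous f3} ->
  L1 (-1) 1 (glue t (glue (- t) f1 f2) f3).
Proof.
move=> h1 h2 h3; apply: L1_glue; rewrite ?(le_trans N1t) //; last exact: continuous_L1.
by apply: L1_glue => //; exact: continuous_L1.
Qed.

Let glue3_primitive (F1 F2 F3 f1 f2 f3 : R -> R) :
  (forall x, -1 <= x <= - t -> is_derive x 1 F1 (f1 x)) ->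
  (forall x, - t <= x <= t -> is_derive x 1 F2 (f2 x)) ->
  (forall x, t <= x <= 1 -> is_derive x 1 F3 (f3 x)) ->
  {within `[-1, - t], continuous f1} ->
  {within `[- t, t], continuous f2} -> {within `[t, 1], continuous f3} ->
  F1 (- t) = F2 (- t) -> F2 t = F3 t ->
  primitive_on (-1) 1 (glue t (glue (- t) F1 F2) F3) (glue t (glue (- t) f1 f2) f3).
Proof.
move=> d1 d2 d3 h1 h2 h3 e1 e2.
have i1 := continuous_L1 h1; have i2 := continuous_L1 h2; have i3 := continuous_L1 h3.
apply: glue_primitive => //; [exact: le_trans N1t tt|exact: L1_glue| |exact: primitive_ftc|].
  by apply: glue_primitive => //; exact: primitive_ftc.
by rewrite glue_gt //; have := t0; lra.
Qed.

Let prim_p : primitive_on (-1) 1 p g.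
Proof. by apply: glue3_primitive. Qed.

Let prim_v : primitive_on (-1) 1 v p.
Proof.
apply: glue3_primitive => //.
- by apply: within_derive => x _; exact: is_derive_pl.
- by apply: within_derive => x; exact: is_derive_dsph.
- by apply: within_derive => x _; exact: is_derive_pr.
Qed.

Let L1_g : L1 (-1) 1 g. Proof. exact: glue3_L1. Qed.

Let L1_g2 : L1 (-1) 1 (fun x => g x ^+ 2).
Proof.
have h := glue3_L1 (@within_continuousX _ _ _ 2 (@cgl (-1) (- t))) (@within_continuousX _ _ _ 2 cont_gs)
  (@within_continuousX _ _ _ 2 (@cgr t 1)).
apply: eq_L1 h => x _; rewrite /g /glue.
by case: (x <= t) => //; case: (x <= - t).
Qed.

Let piece x : -1 <= x <= 1 ->
  [\/ [/\ -1 <= x <= - t, v x = vl x, p x = pl x & g x = gl x],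
      [/\ - t < x <= t, v x = sph x, p x = - x / sph x & g x = - r ^+ 2 / sph x ^+ 3] |
      [/\ t < x <= 1, v x = vr x, p x = pr x & g x = gr x]].
Proof.
move=> /andP[x1 x2]; rewrite /v /p /g /glue.
have [xt|tx] := leP x t; last by constructor 3; rewrite x2.
by have [xt'|tx'] := leP x (- t); [constructor 1; rewrite x1|constructor 2].
Qed.

Let v_even x : v (- x) = v x.
Proof.
wlog x0 : x / 0 <= x => [hw|].
  by have [|/ltW xn] := leP 0 x; [exact: hw|have := hw (- x); rewrite opprK oppr_ge0 => ->].
rewrite /v /glue.
have -> : - x <= t by have := t0; lra.
have [xt|tx] := leP x t.
  rewrite lerN2; have -> : (x <= - t) = false by apply/negbTE; rewrite -ltNge; have := t0; lra.
  (* At [x = t] the convention of [glue] selects the sphere at [t] but the catenoid at [- t];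
     [v_left] reconciles the two. *)
  have [tx|_] := leP t x; last by rewrite /sph sqrrN.
  have -> : x = t by apply/eqP; rewrite eq_le xt.
  by rewrite v_left /sph sqrrN.
by rewrite lerN2 (ltW tx) /vl /vr mulrN mulNr.
Qed.

Let v_gt0 x : -1 <= x <= 1 -> 0 < v x.
Proof.
case/piece => -[xI -> _ _]; [|apply: sph_gt0|]; last 1 first.
- exact: mulr_gt0 alpha0 (coshR_gt0 _).
- exact: mulr_gt0 alpha0 (coshR_gt0 _).
- by case/andP: xI => /ltW -> ->.
Qed.

Lemma inN_catenoid_sphere : inN alpha v p g.
Proof.
have itvE x : I11 x -> -1 <= x <= 1 by rewrite /I11 /= in_itv.
have vN1 : v (-1) = alpha.
  rewrite /v !glue_le //; last by have := t0; lra.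
  by rewrite /vl mulrN1 subrr /coshR oppr0 expR0; field.
have pN1 : p (-1) = 0.
  rewrite /p !glue_le //; last by have := t0; lra.
  by rewrite /pl mulrN1 subrr sinhR0.
have int_prim (F f : R -> R) x : primitive_on (-1) 1 F f -> I11 x ->
    F x = F (-1) + Int (-1) x f.
  by move=> Ff /itvE /andP[x1 x2]; rewrite -Ff // addrC subrK.
split.
- split.
  + exact: L1_measurable L1_g.
  + exact: L1_g.
  + exact: L1_g2.
  + by move=> x; exact: int_prim.
  + by move=> x; exact: int_prim.
- by move=> x _; exact: v_even.
- by move=> x /itvE; exact: v_gt0.
- by split => //; rewrite -v_even.
(* If [t] were 1 the sphere would reach the end of the interval; by [ky] this forces [y = 0],
   against [sinh y > 0]. *)
- split => //; have [t_eq|t_lt] := eqVneq t 1.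
    by move: ky s0; rewrite t_eq subrr mulr0 => <-; rewrite sinhR0 ltxx.
  by rewrite /p glue_gt ?lt_neqAle ?t_lt // /pr mulNr mulr1 subrr sinhR0 oppr0.
Qed.

Let ds_sinh z : ds (sinhR z) = coshR z.
Proof. by rewrite /ds -cosh_sqr sqrtr_sqr ger0_norm // ltW // coshR_gt0. Qed.
Let ds_sinhN z : ds (- sinhR z) = coshR z.
Proof. by rewrite -ds_sinh /ds sqrrN. Qed.
Let ds_sph x : - t <= x <= t -> ds (- x / sph x) = r / sph x.
Proof.
move=> xt; have s := sph_gt0 xt; have e := sphE xt.
have : ds (- x / sph x) ^+ 2 = (r / sph x) ^+ 2.
  rewrite ds_sqr; have -> : (r / sph x) ^+ 2 = (sph x ^+ 2 + x ^+ 2) / sph x ^+ 2.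
    by rewrite expr_div_n e subrK.
  by field; lra.
move/eqP; rewrite eqrXn2 ?(ltW (ds_gt0 _)) ?divr_ge0 ?ltW // => /eqP ->//.
Qed.

(** On the sphere the density is constantly [r]; on the catenoid it is [alpha * cosh^2 z] with
    [z <= y], largest at the junction, where it equals [r]. *)
Lemma k2_catenoid_sphere x : -1 <= x <= 1 -> k2 (v x) (p x) <= r.
Proof.
have cat z : 0 <= z -> z <= y -> alpha * coshR z * coshR z <= r.
  move=> z0 zy; rewrite -mulrA -expr2 ler_pM2l // lerXn2r ?nnegrE ?(ltW (coshR_gt0 _)) //.
  exact: coshR_le.
have kle z : z <= 1 - t -> k * z <= y by rewrite -ky ler_pM2l.
case/piece => -[/andP[x1 x2] -> -> _]; rewrite /k2.
- rewrite ds_sinh; have e : k + k * x = k * (1 + x) by ring.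
  by apply: cat; rewrite e; [rewrite mulr_ge0 ?(ltW k0) //; lra|apply: kle; lra].
- by rewrite ds_sph ?(ltW x1) // mulrC divfK // gt_eqF // sph_gt0 // (ltW x1).
- rewrite ds_sinhN; have e : k + - k * x = k * (1 - x) by ring.
  by apply: cat; rewrite e; [rewrite mulr_ge0 ?(ltW k0) //; lra|apply: kle; lra].
Qed.

(* Both principal curvatures cancel on the catenoid and equal 1 / r on the sphere. *)
Lemma Int_wint_catenoid_sphere : Int (-1) 1 (wint v p g) = 8 * tanhR y.
Proof.
(* On the sphere [u * s = r], and the difference of the two terms under the square is [2 / r],
   whence [4 / r]. Over the length [2 * t] this integrates to [8 * t / r], and [t / r = tanh y]. *)
pose f := glue t (glue (- t) (cst 0) (cst (4 / r))) (cst (0 : R)).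
have N11 : -1 <= 1 :> R by lra.
have -> : Int (-1) 1 (wint v p g) = Int (-1) 1 f.
  apply: eq_Int => x xI; rewrite /wint /f /glue.
  have cat z : 0 < coshR z -> (1 / (alpha * coshR z * coshR z) - k * coshR z / (coshR z ^+ 2 * coshR z)) = 0.
    by move=> cz; rewrite /k; field; rewrite !gt_eqF.
  case/piece: xI => -[/andP[x1 x2] -> -> ->].
  - have -> : x <= t by have := t0; lra.
    by rewrite x2 -ds_sqr ds_sinh cat ?coshR_gt0 // expr0n mul0r.
  - rewrite x2; have -> : (x <= - t) = false by apply/negbTE; rewrite -ltNge.
    have xt : - t <= x <= t by rewrite (ltW x1).
    rewrite -ds_sqr ds_sph //; have s := sph_gt0 xt.
    by move: (sph x) s => S s; rewrite /=; field; rewrite !gt_eqF.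
  - have -> : (x <= t) = false by apply/negbTE; rewrite -ltNge.
    by rewrite -ds_sqr ds_sinhN cat ?coshR_gt0 // expr0n mul0r.
pose F := glue t (glue (- t) (cst 0) (fun x => 4 / r * t + 4 / r * x)) (cst (8 * t / r)).
have Ff : primitive_on (-1) 1 F f.
  apply: glue3_primitive.
  - move=> x _; have := is_derive_comp_affine (4 / r * t) (4 / r) x (fun z => is_derive_id z (1 : R)).
    by rewrite mulr1.
  - by move=> x; exact: cvg_cst.
  - by move=> x; exact: cvg_cst.
  - by move=> x; exact: cvg_cst.
  - by rewrite mulrN subrr.
  - by rewrite /=; field; rewrite gt_eqF.
rewrite -Ff // /F [glue _ _ _ (-1)]glue_le; last by have := t0; lra.
rewrite [glue (- t) _ _ (-1)]glue_le // /= subr0.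
have -> : tanhR y = t / r by rewrite /tanhR /t /r; field; rewrite !gt_eqF.
rewrite /glue; case: ifP => [h|_]; last by rewrite mulrA.
have -> : t = 1 by have := t1; lra.
case: ifP => [h'|_]; first by have := t0; lra.
by field; rewrite gt_eqF.
Qed.

Lemma catenoid_sphere : exists v p g, [/\ inN alpha v p g,
  Int (-1) 1 (wint v p g) = 8 * tanhR y &
  Int (-1) 1 (fun x => k2 (v x) (p x)) <= 2 * (alpha * coshR y ^+ 2)].
Proof.
exists v, p, g; split; [exact: inN_catenoid_sphere|exact: Int_wint_catenoid_sphere|].
have N11 : -1 <= 1 :> R by lra.
have -> : 2 * (alpha * coshR y ^+ 2) = Int (-1) 1 (cst r) by rewrite Int_cst // /r; ring.
apply: le_Int; [exact: inN_L1_k2 inN_catenoid_sphere|exact: L1_cst|].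
exact: k2_catenoid_sphere.
Qed.

End CatenoidSphere.

(** The intermediate value theorem: at [1 / (2 * alpha)] the bound [sinh z * cosh z >= z] makes the
    left side at least 1. The resulting upper bound on [y] is what brings [tanh (1 / (2 * alpha))]
    into play. *)
Lemma catenoid_parameter (R : realType) (alpha : R) : 0 < alpha ->
  exists y, [/\ 0 <= y, y <= 1 / (2 * alpha) & alpha * (y + sinhR y * coshR y) = 1].
Proof.
move=> alpha0; pose b := 1 / (2 * alpha).
have b0 : 0 <= b by rewrite divr_ge0 // mulr_ge0 // ltW.
pose f z : R := alpha * (z + sinhR z * coshR z).
have cf : continuous f.
  move=> z; apply: cvgM; first exact: cvg_cst.
  apply: cvgD; first exact: cvg_id.
  apply: cvgM; first exact: (continuous_derive (@is_derive_sinhR R)).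
  exact: (continuous_derive (@is_derive_coshR R)).
have f0 : f 0 = 0 by rewrite /f sinhR0 mul0r addr0 mulr0.
have fb : 1 <= f b.
  have bs : b <= sinhR b * coshR b.
    rewrite (le_trans (sinhR_ge b0)) // ler_peMr ?coshR_ge1 //.
    exact: le_trans b0 (sinhR_ge b0).
  have e : alpha * (b + b) = 1 by rewrite /b; field; lra.
  by rewrite -[leLHS]e /f ler_pM2l // lerD2l.
have [|y] := @IVT R f 0 b 1 b0 (continuous_subspaceT cf).
  by rewrite ge_min f0 ler01 le_max fb orbT.
by rewrite in_itv /= => /andP[y0 yb] fy; exists y.
Qed.

(** Writing 1 as the square of [yE] makes the claim homogeneous in [alpha]: with s = sinh y and c =
    cosh y it reads c^4 <= (y + s c)^2 + 1. As c^4 = 1 + s^2 + s^2 c^2, it remains to see s^2 <= y^2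
    + 2 y s c. *)
Lemma catenoid_radius_le (R : realType) (alpha y : R) : 0 < alpha -> 0 <= y ->
  alpha * (y + sinhR y * coshR y) = 1 -> alpha * coshR y ^+ 2 <= Num.sqrt (1 + alpha ^+ 2).
Proof.
move=> alpha0 y0 yE; rewrite -[leLHS]ger0_norm; last first.
  by rewrite mulr_ge0 ?exprn_ge0 ?ltW ?coshR_gt0.
rewrite -sqrtr_sqr ler_sqrt ?addr_ge0 ?sqr_ge0 //.
have -> : 1 + alpha ^+ 2 = alpha ^+ 2 * ((y + sinhR y * coshR y) ^+ 2 + 1).
  by rewrite mulrDr mulr1 -exprMn yE expr1n.
rewrite exprMn ler_pM2l ?exprn_gt0 //.
have s0 : 0 <= sinhR y := le_trans y0 (sinhR_ge y0).
have h := sinhR_le_coshR y0; have cs := cosh_sqr y.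
move: (sinhR y) (coshR y) s0 h cs => s c s0 h cs.
have h' : s * s <= s * (2 * y * c) by rewrite ler_wpM2l.
have y2 := sqr_ge0 y.
have -> : (y + s * c) ^+ 2 = y ^+ 2 + s * (2 * y * c) + s ^+ 2 * c ^+ 2 by ring.
rewrite cs; have -> : (1 + s ^+ 2) ^+ 2 = 1 + s * s + s ^+ 2 * (1 + s ^+ 2) by ring.
by lra.
Qed.

Unset Implicit Arguments.
Local Close Scope classical_set_scope.

Theorem theorem3p4 (R : realType) (alpha eps : R) :
  0 < alpha -> 0 <= eps ->
  ((1 / 4 < alpha /\ eps < 1 / alpha) \/
   eps <= (1 - tanhR (1 / (2 * alpha))) /
          (Num.sqrt (1 + alpha ^+ 2) + alpha / 4
           + alpha ^+ 2 / 4 * sinhR (1 / alpha) - 1 / 4)) ->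
  exists u u1 g : R -> R,
    inN alpha u u1 g /\
    forall v v1 h : R -> R, inN alpha v v1 h ->
      (helfrichF eps u u1 g <= helfrichF eps v v1 h)%E.
Proof.
move=> alpha0 eps0 [[alpha4 epsa]|epsD]; first exact: minimizer_cylinder.
have [y [y0 yb yE]] := catenoid_parameter alpha0.
have [v [p [g [vN vW vA]]]] := catenoid_sphere alpha0 y0 yE.
apply: (@minimizer_exists_lt R alpha eps v p g) => //.
set D := _ - 1 / 4 in epsD.
(* It has to be shown that the terms of [D] after the square root have positive sum. With the cubic
   bound on sinh they are at least [alpha / 2 + 1 / (27 * alpha) - 1 / 4], which is positive for
   every [alpha]; the linear bound alone would fail for small [alpha]. *)
have rD : alpha * coshR y ^+ 2 < D.
  apply: le_lt_trans (catenoid_radius_le alpha0 y0 yE) _; rewrite /D.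
  have ia0 : 0 <= 1 / alpha by rewrite divr_ge0 // ltW.
  have h : 1 / alpha + 4 / 27 * (1 / alpha) ^+ 3 <= sinhR (1 / alpha) by exact: sinhR_ge_cubic.
  have h' : alpha ^+ 2 / 4 * (1 / alpha + 4 / 27 * (1 / alpha) ^+ 3) <=
      alpha ^+ 2 / 4 * sinhR (1 / alpha).
    by rewrite ler_wpM2l // divr_ge0 // sqr_ge0.
  have e : alpha ^+ 2 / 4 * (1 / alpha + 4 / 27 * (1 / alpha) ^+ 3) = alpha / 4 + (27 * alpha)^-1.
    by field; lra.
  rewrite e in h'.
  have q : 1 / 4 < alpha / 2 + (27 * alpha)^-1.
    rewrite -subr_gt0 (_ : _ - _ = (alpha ^+ 2 / 2 - alpha / 4 + 1 / 27) / alpha); last by field; lra.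
    rewrite divr_gt0 //; have := sqr_ge0 (alpha - 1 / 4); lra.
  lra.
have c20 : 0 <= alpha * coshR y ^+ 2 by rewrite mulr_ge0 ?sqr_ge0 // ltW.
have D0 : 0 < D := le_lt_trans c20 rD.
have th : tanhR y <= tanhR (1 / (2 * alpha)) := tanhR_le yb.
have th1 := tanhR_lt1 (1 / (2 * alpha)).
have epsD' : eps * D <= 1 - tanhR (1 / (2 * alpha)) by rewrite -ler_pdivlMr.
have pi0 := @pi_gt0 R.
have : tanhR y + eps * (alpha * coshR y ^+ 2) < 1.
  (* Strictness comes from [tanh < 1] when [eps = 0], and from [r < D] otherwise. The left side
     times 4 pi bounds the energy of the competitor. *)
  have [e0|eN0] := eqVneq eps 0; first by rewrite e0 mul0r; lra.
  have : eps * (alpha * coshR y ^+ 2) < eps * D.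
    by rewrite ltr_pM2l // lt_neqAle eq_sym eN0.
  lra.
rewrite (energyE _ vN) vW => lt1.
have : eps * Int (-1) 1 (fun x => k2 (v x) (p x)) <= eps * (2 * (alpha * coshR y ^+ 2)).
  by rewrite ler_wpM2l.
move: (Int _ _ _) => A hA.
have : pi * (tanhR y + eps * A / 2) < pi * 1 by rewrite ltr_pM2l //; lra.
lra.
Qed.
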